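(* Let $\widetilde{W}$ be an (irreducible) affine Weyl group of any type. Then $\widetilde{W}$ has a Coxeter node, and the Coxeter node is unique if $\widetilde{W}$ is not an affine symmetric group (i.e. not of type $\widetilde{A_n}$, $n\geq 1$). Consequently, for every Coxeter element $c$ of $\widetilde{W}$, the limit element $[c^\infty]$ is a minimal element of the limit weak order $\widetilde{\mathcal{W}}$.
   Context: Setup. $\Phi$ is an irreducible reduced crystallographic root system spanning the Euclidean space $V$ with inner product $\langle\cdot,\cdot\rangle$, with simple roots $\alpha_1,\dots,\alpha_n$, highest root $\xi$, and finite Weyl group $W$ with simple reflections $s_1,\dots,s_n$. Simple coroots: $\alpha_i^\vee=\frac{2}{\langle\alpha_i,\alpha_i\rangle}\alpha_i$; coroot lattice $Q^\vee=\bigoplus_i\mathbb{Z}\alpha_i^\vee$; fundamental coweights $\omega_i^\vee$ defined by $\langle\alpha_i,\omega_j^\vee\rangle=\delta_{ij}$; $k_i$ is the smallest positive integer with $k_i\omega_i^\vee\in Q^\vee$. The affine Weyl group is $\widetilde{W}=W\ltimes Q^\vee$, acting on $V$ by affine transformations, where $\lambda\in Q^\vee$ corresponds to translation $t_\lambda$ by $\lambda$. It is a Coxeter group with simple reflections $s_0,s_1,\dots,s_n$, where $s_0$ is reflection across the hyperplane $\{x:\langle x,\xi\rangle=1\}$. Limit weak order. An infinite reduced word of $\widetilde{W}$ is a sequence $\mathbf{i}=i_1i_2\cdots$ in $\{0,\dots,n\}$ such that every finite prefix $s_{i_1}\cdots s_{i_k}$ is a reduced word. Its inversion set $\mathrm{Inv}(\mathbf{i})$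 is the set of reflections $s_{i_1}\cdots s_{i_{k-1}}s_{i_k}s_{i_{k-1}}\cdots s_{i_1}$, $k\ge1$. $[\mathbf{i}]$ denotes the class of $\mathbf{i}$, where $[\mathbf{i}]=[\mathbf{j}]$ iff $\mathrm{Inv}(\mathbf{i})=\mathrm{Inv}(\mathbf{j})$; such classes are called limit elements. The limit weak order $\widetilde{\mathcal{W}}$ is the set of limit elements of $\widetilde W$ partially ordered by containment of inversion sets. Coxeter elements, infinite powers, Coxeter nodes. A Coxeter element of $\widetilde{W}$ is a product of all the simple reflections $s_0,\dots,s_n$, each appearing once, in some order. For $x=c$ a Coxeter element or $x=t_\lambda$ ($0\neq\lambda\in Q^\vee$), $x^\infty$ denotes the infinite word obtained by repeating a reduced word of $x$ infinitely often; it is known that this is an infinite reduced word and that $[x^\infty]$ does not depend on the chosen reduced word of $x$. A node $\alpha_i$ ($1\le i\le n$) is a Coxeter node for $\widetilde{W}$ if $[t_{wk_i\omega_i^\vee}^\infty]=[c^\infty]$ for some $w\in W$ and some Coxeter element $c$ of $\widetilde{W}$. *)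

(* Defs.v *)
From HB Require Import structures.
From mathcomp Require Import all_boot all_order all_algebra all_fingroup.
From mathcomp Require Import finmap.
From mathcomp Require Import all_classical all_reals.
From mathcomp Require Import sesquilinear.

Set Implicit Arguments.
Unset Strict Implicit.
Unset Printing Implicit Defensive.

Import Order.TTheory GRing.Theory Num.Theory.
Local Open Scope ring_scope.
Local Open Scope classical_set_scope.

Section RootSystems.
Variables (R : realType) (V : vectType R) (dot : {dot V for idfun}).

Definition coroot (a : V) : V := (2 / dot a a) *: a.

(* Orthogonal reflection across the hyperplane <x, a> = k. *)
Definition refl (a : V) (k : R) (x : V) : V := x - (dot x a - k) *: coroot a.

Definition translation (v x : V) : V := x + v.

Definition root_system (Phi : {fset V}) : Prop :=
  [/\ 0 \notin Phi,
      <<Phi>>%VS = fullv,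
      forall a b, a \in Phi -> b \in Phi -> refl a 0 b \in Phi,
      forall a b, a \in Phi -> b \in Phi -> dot b (coroot a) \is a Num.int
    & forall a (t : R), a \in Phi -> t *: a \in Phi -> t = 1 \/ t = -1].

Definition irreducible_root_system (Phi : {fset V}) : Prop :=
  Phi != fset0%fset /\
  forall A B : {fset V}, Phi = (A `|` B)%fset ->
    (forall a b, a \in A -> b \in B -> dot a b = 0) ->
    A = fset0%fset \/ B = fset0%fset.

Variable n : nat.
Implicit Types alpha omega : 'I_n -> V.

Definition nonneg_comb alpha (x : V) : Prop :=
  exists m : 'I_n -> nat, x = \sum_i alpha i *+ m i.

Definition simple_roots (Phi : {fset V}) alpha : Prop :=
  [/\ forall i, alpha i \in Phi,
      basis_of fullv [seq alpha i | i <- enum 'I_n]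
    & forall b, b \in Phi -> nonneg_comb alpha b \/ nonneg_comb alpha (- b)].

Definition highest_root (Phi : {fset V}) alpha (xi : V) : Prop :=
  xi \in Phi /\ forall b, b \in Phi -> nonneg_comb alpha (xi - b).

Definition coroot_lattice alpha : set V :=
  [set x | exists m : 'I_n -> int, x = \sum_i coroot (alpha i) *~ m i].

Definition fundamental_coweights alpha omega : Prop :=
  forall i j, dot (alpha i) (omega j) = (i == j)%:R.

Definition least_coweight_multiples alpha omega (k : 'I_n -> nat) : Prop :=
  forall i,
    [/\ (0 < k i)%N,
        coroot_lattice alpha (omega i *+ k i)
      & forall m, (0 < m)%N -> coroot_lattice alpha (omega i *+ m) ->
          (k i <= m)%N].

(* The submonoid generated by the reflections is the group they generate, as
   reflections are involutions. *)
Definition weyl_group (Phi : {fset V}) : set (V -> V) :=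
  [set w | exists bs : seq V, {subset bs <= Phi} /\
     w = foldr (fun b f => refl b 0 \o f) id bs].

(* The numbering of the nodes along the Dynkin diagram is arbitrary, hence the
   permutation p. *)
Definition type_A alpha : Prop :=
  exists p : 'S_n, forall i j : 'I_n,
    dot (alpha (p j)) (coroot (alpha (p i))) =
      if i == j then 2
      else if (i.+1 == j :> nat) || (j.+1 == i :> nat) then -1 else 0.

Section AffineWeylGroup.
Variables (alpha : 'I_n -> V) (xi : V).

(* Index 0 is the affine reflection; index i.+1 is the i-th simple root. *)
Definition simple_refl (j : 'I_n.+1) : V -> V :=
  if unlift ord0 j is Some i then refl (alpha i) 0 else refl xi 1.

(* Elements of the affine Weyl group are represented by their (faithful) action
   on V, so products are compositions. *)
Definition word_prod (u : seq 'I_n.+1) : V -> V :=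
  foldr (fun j f => simple_refl j \o f) id u.

Definition reduced (u : seq 'I_n.+1) : Prop :=
  forall v, word_prod v = word_prod u -> (size u <= size v)%N.

Definition infinite_word := nat -> 'I_n.+1.
Implicit Types i j : infinite_word.

Definition infinite_reduced i : Prop := forall k, reduced (mkseq i k).

Definition Inv i : set (V -> V) :=
  [set t | exists k, t = word_prod (mkseq i k ++ i k :: rev (mkseq i k))].

Definition limit_class i : set infinite_word :=
  [set j | infinite_reduced j /\ Inv j = Inv i].

Definition limit_elements : set (set infinite_word) :=
  [set X | exists2 i, infinite_reduced i & X = limit_class i].

Definition limit_le (X Y : set infinite_word) : Prop :=
  exists i j, [/\ X i, Y j & Inv i `<=` Inv j].

Definition minimal_limit_element (X : set infinite_word) : Prop :=
  limit_elements X /\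
  forall Y, limit_elements Y -> limit_le Y X -> Y = X.

Definition infinite_repeat (u : seq 'I_n.+1) : infinite_word :=
  fun k => nth ord0 u (k %% size u)%N.

(* The class [x^oo], as the union of the classes of u^oo over all reduced words
   u of x; for x a Coxeter element or a nontrivial translation in the affine
   Weyl group these classes all coincide, so that no choice of u is needed. *)
Definition limit_power (x : V -> V) : set infinite_word :=
  [set j | exists u, [/\ reduced u, word_prod u = x
                       & limit_class (infinite_repeat u) j]].

Definition coxeter_element (c : V -> V) : Prop :=
  exists2 u, perm_eq u (enum 'I_n.+1) & c = word_prod u.

Definition coxeter_node (Phi : {fset V}) omega (k : 'I_n -> nat) (i : 'I_n) :
    Prop :=
  exists w c, [/\ weyl_group Phi w, coxeter_element c
    & limit_power (translation (w (omega i *+ k i))) = limit_power c].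

End AffineWeylGroup.
End RootSystems.

(* Main.v *)
(* A vector v directs an infinite word if all walls crossed by its gallery have
   direction negative on v; such a word is reduced, because a failure of
   reducedness would produce two crossed affine roots opposite to each other.
   If v spans the ray of some w(omega_i), then every word directed by v crosses
   all walls with direction negative on v: otherwise the gallery would stay in a
   bounded region. So all words directed by v have the same inversion set, and
   this set is minimal. The powers of the translation by w(k_i omega_i) are
   directed by omega_i moved by w.

   For a Coxeter element c with word u, the relation xi = sum m_i alpha_i gives
   an explicit vector v directing the powers of c and fixed by its linear part.
   The fixed space of that linear part is the line of v. After moving v into the
   dominant chamber its stabilizer is generated by simple reflections, so every
   omega_i with <alpha_i, v> nonzero is fixed too, hence proportional to v.

   The vector v depends only on the orientation of the affine diagram given by
   u, and moving an initial letter of u to the end applies a simple reflection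
   to v. If the diagram is a forest, block rotations reverse one edge at a time,
   so all v are in one Weyl orbit and the node is unique. If the diagram has a
   cycle, the unit vectors along the roots of the cycle have sum 0, which forces
   the cycle to be the whole diagram with simple bonds: type A. *)
Require Import Defs.
From HB Require Import structures.
From mathcomp Require Import all_boot all_order all_algebra all_fingroup.
From mathcomp Require Import finmap.
From mathcomp Require Import all_classical all_reals.
From mathcomp Require Import sesquilinear.
From mathcomp Require Import ring lra zify.

Set Implicit Arguments.
Unset Strict Implicit.
Unset Printing Implicit Defensive.

Import Order.TTheory GRing.Theory Num.Theory.
Local Open Scope ring_scope.

(** * Affine forms and reflections *)

Section AffineForms.
Variables (R : realType) (V : vectType R) (dot : {dot V for idfun}).
Implicit Types (a b x y v : V) (f g h : V * R).

Local Notation coroot := (coroot dot).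
Local Notation refl := (refl dot).

Lemma dotC x y : dot x y = dot y x.
Proof. by rewrite hermC expr0 mul1r. Qed.

Lemma dot_gt0 x : x != 0 -> 0 < dot x x.
Proof. exact: neq0_dnorm_gt0. Qed.

Lemma dotDl x y v : dot (x + y) v = dot x v + dot y v.
Proof. exact: linearDl. Qed.

Lemma dotDr v x y : dot v (x + y) = dot v x + dot v y.
Proof. exact: linearDr. Qed.

Lemma dotNl x v : dot (- x) v = - dot x v.
Proof. exact: linearNl. Qed.

Lemma dotNr v x : dot v (- x) = - dot v x.
Proof. exact: linearNr. Qed.

Lemma dotZl (c : R) x v : dot (c *: x) v = c * dot x v.
Proof. exact: linearZl_LR. Qed.

Lemma dotZr (c : R) v x : dot v (c *: x) = c * dot v x.
Proof. exact: linearZr_LR. Qed.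

Lemma dot0l v : dot 0 v = 0.
Proof. exact: linear0l. Qed.

Lemma dot0r v : dot v 0 = 0.
Proof. exact: linear0r. Qed.

Lemma dot_suml I (r : seq I) (P : pred I) (F : I -> V) v :
  dot (\sum_(i <- r | P i) F i) v = \sum_(i <- r | P i) dot (F i) v.
Proof. exact: linear_sumlz. Qed.

Lemma dot_sumr I (r : seq I) (P : pred I) (F : I -> V) v :
  dot v (\sum_(i <- r | P i) F i) = \sum_(i <- r | P i) dot v (F i).
Proof. exact: linear_sumr. Qed.

Definition dotE := (dotDl, dotDr, dotNl, dotNr, dotZl, dotZr, dot0l, dot0r).

Lemma dot_eq0 x : (dot x x == 0) = (x == 0).
Proof.
apply/eqP/eqP => [|->]; last by rewrite dot0l.
by apply: contra_eq => x0; rewrite gt_eqF // dot_gt0.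
Qed.

Lemma dot_ge0 x : 0 <= dot x x.
Proof. by have [->|/dot_gt0/ltW//] := eqVneq x 0; rewrite dot0l. Qed.

Lemma reflE a k x : refl a k x = x - ((dot x a - k) * (2 / dot a a)) *: a.
Proof. by rewrite /Defs.refl /Defs.coroot scalerA. Qed.

Definition cartan b a : R := dot b a * (2 / dot a a).

Lemma dot_coroot b a : dot b (coroot a) = cartan b a.
Proof. by rewrite /Defs.coroot dotZr mulrC. Qed.

Lemma cartan_self a : a != 0 -> cartan a a = 2.
Proof. by move=> a0; rewrite /cartan mulrCA divff ?mulr1 // dot_eq0. Qed.

Lemma refl0E a x : refl a 0 x = x - cartan x a *: a.
Proof. by rewrite reflE subr0. Qed.

Lemma refl0D a x y : refl a 0 (x + y) = refl a 0 x + refl a 0 y.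
Proof.
by rewrite !refl0E /cartan dotDl mulrDl scalerDl opprD addrACA.
Qed.

Lemma refl0Z a (c : R) x : refl a 0 (c *: x) = c *: refl a 0 x.
Proof. by rewrite !refl0E /cartan dotZl -mulrA scalerBr scalerA. Qed.

Lemma reflB a k x y : refl a k x - refl a k y = refl a 0 (x - y).
Proof.
rewrite !reflE opprD opprK addrACA; congr (_ + _).
by rewrite -!scaleNr -scalerDl dotDl dotNl; congr (_ *: _); ring.
Qed.

Lemma refl_isom a x y : dot (refl a 0 x) (refl a 0 y) = dot x y.
Proof.
have [->|a0] := eqVneq a 0; first by rewrite !reflE !scaler0 !subr0.
have aa : dot a a != 0 by rewrite dot_eq0.
rewrite !reflE !subr0 !dotE (dotC a y).
by field.
Qed.

Lemma reflK a k : a != 0 -> involutive (refl a k).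
Proof.
move=> a0 x; have aa : dot a a != 0 by rewrite dot_eq0.
rewrite !reflE !dotE -addrA -opprD -scalerDl [X in X *: _](_ : _ = 0).
  by rewrite scale0r subr0.
by field.
Qed.

Lemma refl0K a : involutive (refl a 0).
Proof.
by move=> x; have [->|/reflK->//] := eqVneq a 0; rewrite !reflE !scaler0 !subr0.
Qed.

Lemma refl_adj a x y : dot (refl a 0 x) y = dot x (refl a 0 y).
Proof. by rewrite -{1}(refl0K a y) refl_isom. Qed.

Lemma reflN a k x : refl (- a) (- k) x = refl a k x.
Proof.
rewrite !reflE !dotE scalerN !opprK -scaleNr; congr (_ + _ *: _).
by ring.
Qed.

(* The pair [(a, z)] stands for the affine form [<a, x> - z]. *)
Definition aff_eval f x : R := dot f.1 x - f.2.

Local Notation ev := aff_eval.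

(** The form [f] composed with the reflection in the zero set of [g], in coordinates (see
    [ev_arefl]). As a reflection is its own inverse, this is also the usual action on affine
    roots. *)
Definition arefl g f : V * R :=
  (f.1 - cartan f.1 g.1 *: g.1, f.2 - cartan f.1 g.1 * g.2).

Lemma arefl_fst g f : (arefl g f).1 = refl g.1 0 f.1.
Proof. by rewrite refl0E. Qed.

Lemma areflN g f : arefl g (- f) = - arefl g f.
Proof.
rewrite /arefl /cartan [(- f).1]/= [(- f).2]/= dotNl !mulNr.
by congr pair => /=; rewrite ?scaleNr !opprK opprB addrC.
Qed.

Lemma arefl_self g : g.1 != 0 -> arefl g g = - g.
Proof.
move=> g0; rewrite /arefl cartan_self //; congr pair => /=.
  by rewrite scaler_nat mulr2n opprD addrA subrr sub0r.
by ring.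
Qed.

Lemma areflK g : g.1 != 0 -> involutive (arefl g).
Proof.
move=> g0 f; have aa : dot g.1 g.1 != 0 by rewrite dot_eq0.
rewrite /arefl /= (_ : cartan (_ - _) _ = - cartan f.1 g.1).
  by rewrite mulNr scaleNr !opprK !subrK; case: (f).
by rewrite /cartan !dotE; field.
Qed.

Lemma ev_arefl g f x : ev (arefl g f) x = ev f (refl g.1 g.2 x).
Proof.
rewrite /aff_eval /arefl /cartan reflE /= !dotE (dotC g.1 x).
by ring.
Qed.

Lemma evN f x : ev (- f) x = - ev f x.
Proof. by rewrite /aff_eval /= dotNl opprB opprK addrC. Qed.

Lemma refl_evE f x : refl f.1 f.2 x = x - (ev f x * (2 / dot f.1 f.1)) *: f.1.
Proof. by rewrite reflE /aff_eval dotC. Qed.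

Lemma refl_conj g f x : g.1 != 0 ->
  refl g.1 g.2 (refl f.1 f.2 x) =
  refl (arefl g f).1 (arefl g f).2 (refl g.1 g.2 x).
Proof.
move=> g0; rewrite [in RHS]refl_evE ev_arefl reflK // !arefl_fst refl_isom.
rewrite [refl f.1 _ _]refl_evE -[LHS](subrK (refl g.1 g.2 x)) reflB.
by rewrite [_ - x]addrAC subrr sub0r -scaleNr refl0Z addrC scaleNr.
Qed.

End AffineForms.

(** * Words acting on points, on directions and on affine forms *)

Section AffineWords.
Variables (R : realType) (V : vectType R) (dot : {dot V for idfun}).
Variables (n : nat) (alpha : 'I_n -> V) (xi : V).
Implicit Types (u : seq 'I_n.+1) (x y : V) (f g : V * R).


(** The affine node carries the form [1 - xi], positive on the fundamental alcove like the simple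
    roots. Its sign is opposite to the wall in [simple_refl], but the reflection is the same by
    [reflN]. *)
Definition aff_root (j : 'I_n.+1) : V * R :=
  if unlift ord0 j is Some i then (alpha i, 0) else (- xi, - 1).

(** The linear part of [word_prod u]; see [word_prodB]. *)
Definition lin_word u x : V :=
  foldr (fun j y => refl dot (aff_root j).1 0 y) x u.

(** Affine forms transported along [word_prod u]: by [ev_act] their values move with the points. *)
Definition act_word u f : V * R := foldr (fun j => arefl dot (aff_root j)) f u.

Local Notation aff := aff_root.
Local Notation lin := lin_word.
Local Notation act := act_word.
Local Notation word_prod := (word_prod dot alpha xi).

Lemma aff0 : aff_root ord0 = (- xi, - 1).
Proof. by rewrite /aff_root unlift_none. Qed.

Lemma affS i : aff_root (lift ord0 i) = (alpha i, 0).
Proof. by rewrite /aff_root liftK. Qed.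

Lemma simple_reflE j x :
  simple_refl dot alpha xi j x = refl dot (aff j).1 (aff j).2 x.
Proof.
by rewrite /simple_refl /aff_root; case: unlift => //=; rewrite reflN.
Qed.

Lemma word_prod_cat u v x : word_prod (u ++ v) x =
  word_prod u (word_prod v x).
Proof. by elim: u => //= j u ->. Qed.

Lemma lin_cat u v x : lin (u ++ v) x = lin u (lin v x).
Proof. by rewrite /lin_word foldr_cat. Qed.

Lemma act_cat u v f : act (u ++ v) f = act u (act v f).
Proof. by rewrite /act_word foldr_cat. Qed.

Lemma act_fst u f : (act u f).1 = lin u f.1.
Proof.
elim: u => // j u IH.
by rewrite [act _ _]/(arefl dot (aff j) (act u f)) arefl_fst IH.
Qed.

Lemma actN u f : act u (- f) = - act u f.
Proof. by elim: u => //= j u ->; rewrite areflN. Qed.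

Lemma linD u x y : lin u (x + y) = lin u x + lin u y.
Proof. by elim: u => //= j u ->; rewrite refl0D. Qed.

Lemma linZ u c x : lin u (c *: x) = c *: lin u x.
Proof. by elim: u => //= j u ->; rewrite refl0Z. Qed.

Lemma lin_isom u x y : dot (lin u x) (lin u y) = dot x y.
Proof. by elim: u => //= j u <-; rewrite refl_isom. Qed.

Lemma word_prodB u x y : word_prod u x - word_prod u y
  = lin u (x - y).
Proof. by elim: u => //= j u <-; rewrite !simple_reflE reflB. Qed.

Lemma word_prodD u x y : word_prod u (x + y) = word_prod u x + lin u y.
Proof.
have := word_prodB u (x + y) x; rewrite [x + y - x]addrAC subrr add0r => <-.
by rewrite [RHS]addrC subrK.
Qed.

Lemma lin_revK u x : lin (rev u) (lin u x) = x.
Proof.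
elim: u x => [|j u IH] x //=.
by rewrite rev_cons -cats1 lin_cat /= refl0K IH.
Qed.

Lemma lin_Krev u x : lin u (lin (rev u) x) = x.
Proof. by rewrite -{1}(revK u) lin_revK. Qed.

Lemma lin_adj u x y : dot (lin u x) y = dot x (lin (rev u) y).
Proof. by rewrite -{1}(lin_Krev u y) lin_isom. Qed.

Lemma lin_sum u I (r : seq I) (P : pred I) (F : I -> V) :
  lin u (\sum_(i <- r | P i) F i) = \sum_(i <- r | P i) lin u (F i).
Proof.
apply: (big_morph _ (linD u)).
by rewrite -(scale0r 0) linZ !scale0r.
Qed.

Section Nonzero.
Hypothesis aff_neq0 : forall j, (aff j).1 != 0.

Lemma word_prod_revK u x :
  word_prod (rev u) (word_prod u x) = x.
Proof.
elim: u x => [|j u IH] x //=.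
by rewrite rev_cons -cats1 word_prod_cat /= !simple_reflE reflK ?IH.
Qed.

Lemma word_prod_Krev u x : word_prod u (word_prod (rev u) x) = x.
Proof. by rewrite -{1}(revK u) word_prod_revK. Qed.

Lemma act_revK u f : act (rev u) (act u f) = f.
Proof.
elim: u f => //= j u IH f.
by rewrite rev_cons -cats1 act_cat /= areflK ?IH.
Qed.

Lemma ev_act u f x :
  aff_eval dot (act u f) (word_prod u x) = aff_eval dot f x.
Proof. by elim: u => //= j u IH; rewrite ev_arefl simple_reflE reflK ?IH. Qed.

Lemma refl_act u f x :
  word_prod u (refl dot f.1 f.2 x) =
  refl dot (act u f).1 (act u f).2 (word_prod u x).
Proof. by elim: u => //= j u ->; rewrite !simple_reflE refl_conj. Qed.

(** Conjugation carries the mirror of the last letter along [u]. This replaces the elements of [Inv]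
    by the affine roots of the walls that the gallery crosses. *)
Lemma word_prod_refl u j : word_prod (u ++ j :: rev u) =
  refl dot (act u (aff j)).1 (act u (aff j)).2.
Proof.
apply/funext => x; rewrite word_prod_cat /= simple_reflE refl_act.
by rewrite word_prod_Krev.
Qed.

End Nonzero.
End AffineWords.


(** * Affine roots *)

Section RootData.
Variables (R : realType) (V : vectType R) (dot : {dot V for idfun}).
Variables (Phi : {fset V}) (n : nat) (alpha : 'I_n -> V) (xi : V).
Variable omega : 'I_n -> V.
Hypothesis Phi_root : root_system dot Phi.
Hypothesis alpha_simple : simple_roots Phi alpha.
Hypothesis xi_highest : highest_root Phi alpha xi.
Hypothesis omega_coweights : fundamental_coweights dot alpha omega.
Implicit Types (a b x y v : V) (f g : V * R) (u : seq 'I_n.+1) (j : 'I_n.+1).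

Local Notation aff := (aff_root alpha xi).
Local Notation act := (act_word dot alpha xi).
Local Notation lin := (lin_word dot alpha xi).
Local Notation word_prod := (word_prod dot alpha xi).
Local Notation ev := (aff_eval dot).

Lemma root_neq0 a : a \in Phi -> a != 0.
Proof. by case: Phi_root => Phi0 _ _ _ _; apply: contraTneq => ->. Qed.

Lemma root_refl a b : a \in Phi -> b \in Phi -> refl dot a 0 b \in Phi.
Proof. by case: Phi_root => _ _ + _ _; apply. Qed.

Lemma rootN a : a \in Phi -> - a \in Phi.
Proof.
move=> Pa; have := root_refl Pa Pa.
rewrite refl0E cartan_self ?root_neq0 //.
by rewrite scaler_nat mulr2n opprD addrA subrr sub0r.
Qed.

Lemma cartan_int a b : a \in Phi -> b \in Phi -> cartan dot b a \is a Num.int.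
Proof.
by case: Phi_root => _ _ _ Pint _ Pa Pb; rewrite -dot_coroot; apply: Pint.
Qed.

Lemma root_scale a (t : R) : a \in Phi -> t *: a \in Phi -> t = 1 \/ t = -1.
Proof. by case: Phi_root => _ _ _ _; apply. Qed.

Lemma alpha_root i : alpha i \in Phi.
Proof. by case: alpha_simple. Qed.

Lemma xi_root : xi \in Phi.
Proof. by case: xi_highest. Qed.

Lemma coweight_expand x : x = \sum_i dot x (omega i) *: alpha i.
Proof.
case: alpha_simple => _ /andP[/eqP span_alpha _] _.
have [c ->] : exists c : 'I_n -> R, x = \sum_i c i *: alpha i.
  have := memvf x; rewrite -span_alpha.
  rewrite (_ : [seq alpha i | i <- enum 'I_n] = [tuple alpha i | i < n]) //.
  move=> /coord_span ->.
  by eexists => /=; apply: eq_bigr => i _; rewrite nth_mktuple.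
apply: eq_bigr => i _; rewrite dot_suml (bigD1 i) //= big1 => [|l li].
  by rewrite dotZl omega_coweights eqxx mulr1 addr0.
by rewrite dotZl omega_coweights (negPf li) mulr0.
Qed.

Lemma simple_eq x y : (forall i, dot (alpha i) x = dot (alpha i) y) -> x = y.
Proof.
move=> xy; apply/eqP; rewrite -subr_eq0 -(dot_eq0 dot).
rewrite {1}(coweight_expand (x - y)) dot_suml big1 // => i _.
by rewrite dotZl [dot (alpha i) _]dotDr dotNr xy subrr mulr0.
Qed.

Lemma nonneg_comb_ge0 x i : nonneg_comb alpha x ->
  0 <= dot x (omega i).
Proof.
move=> [m ->]; rewrite dot_suml sumr_ge0 // => l _.
by rewrite -scaler_nat dotZl omega_coweights mulr_ge0 ?ler0n.
Qed.

Lemma root_le_xi a i : a \in Phi -> dot a (omega i) <= dot xi (omega i).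
Proof.
move=> Pa; have [_ /(_ _ Pa) /(nonneg_comb_ge0 i)] := xi_highest.
by rewrite dotDl dotNl subr_ge0.
Qed.

Lemma xi_ge1 i : 1 <= dot xi (omega i).
Proof.
by have := root_le_xi i (alpha_root i); rewrite omega_coweights eqxx.
Qed.

(** * Marks and coordinates with respect to the affine simple roots *)

Definition mark j : R :=
  if unlift ord0 j is Some i then dot xi (omega i) else 1.

(** Only the affine node has a constant term, so its coordinate is [- f.2]; the multiple of [xi]
    that it brings is compensated at the other nodes. *)
Definition coef f j : R :=
  if unlift ord0 j is Some i then dot f.1 (omega i) - f.2 * dot xi (omega i)
  else - f.2.

Lemma mark_gt0 j : 0 < mark j.
Proof.
by rewrite /mark; case: unlift => [i|] //; apply: lt_le_trans (xi_ge1 i).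
Qed.

Lemma coef0 f : coef f ord0 = - f.2.
Proof. by rewrite /coef unlift_none. Qed.

Lemma coefS f i :
  coef f (lift ord0 i) = dot f.1 (omega i) - f.2 * dot xi (omega i).
Proof. by rewrite /coef liftK. Qed.

Lemma mark0 : mark ord0 = 1.
Proof. by rewrite /mark unlift_none. Qed.

Lemma markS i : mark (lift ord0 i) = dot xi (omega i).
Proof. by rewrite /mark liftK. Qed.

Lemma mark_sum : \sum_j mark j *: (aff j).1 = 0.
Proof.
rewrite big_ord_recl mark0 aff0 scale1r /= {1}(coweight_expand xi).
apply/eqP; rewrite addrC subr_eq0; apply/eqP; apply: eq_bigr => i _.
by rewrite markS affS.
Qed.

Lemma coef_sum1 f : \sum_j coef f j *: (aff j).1 = f.1.
Proof.
rewrite big_ord_recl coef0 aff0 /= scaleNr scalerN opprK.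
rewrite {1}(coweight_expand xi) scaler_sumr -big_split /=.
rewrite [RHS]coweight_expand; apply: eq_bigr => i _.
by rewrite coefS affS scalerA -scalerDl addrC subrK.
Qed.

Lemma coef_sum2 f : \sum_j coef f j * (aff j).2 = f.2.
Proof.
rewrite big_ord_recl coef0 aff0 /= mulrN1 opprK big1 ?addr0 // => i _.
by rewrite affS mulr0.
Qed.

Lemma coef_aff j l : coef (aff j) l = (j == l)%:R.
Proof.
case: (unliftP ord0 j) => [i ->|->]; case: (unliftP ord0 l) => [p ->|->];
  rewrite ?coefS ?coef0 ?affS ?aff0 /= ?opprK ?oppr0 //.
- by rewrite omega_coweights mul0r subr0 (inj_eq (@lift_inj _ ord0)).
- by rewrite dotNl mulN1r opprK addNr.
Qed.

Lemma coef_arefl g f j :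
  coef (arefl dot g f) j = coef f j - cartan dot f.1 g.1 * coef g j.
Proof.
rewrite /coef /arefl; case: unlift => [i|] /=; last by ring.
by rewrite !dotE; ring.
Qed.

Lemma coefN f j : coef (- f) j = - coef f j.
Proof. by rewrite /coef; case: unlift => [i|] //=; rewrite dotNl; ring. Qed.

(** * Affine roots and their signs *)

Definition aroot f : Prop := f.1 \in Phi /\ f.2 \is a Num.int.

Lemma aroot_aff j : aroot (aff j).
Proof.
rewrite /aff_root; case: unlift => [i|]; split => //=.
- exact: alpha_root.
- exact: rootN xi_root.
- by rewrite rpredN rpred1.
Qed.

Lemma aff_neq0 j : (aff j).1 != 0.
Proof. by apply: root_neq0; case: (aroot_aff j). Qed.

Lemma aroot_arefl g f : aroot g -> aroot f -> aroot (arefl dot g f).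
Proof.
move=> [Pg Zg] [Pf Zf]; split; first by rewrite arefl_fst root_refl.
by rewrite /= rpredB // rpredM // cartan_int.
Qed.

Lemma arootN f : aroot f -> aroot (- f).
Proof. by move=> [Pf Zf]; split; rewrite /= ?rootN // rpredN. Qed.

Lemma aroot_act u f : aroot f -> aroot (act u f).
Proof.
by move=> Pf; elim: u => //= j u IH; apply: aroot_arefl (aroot_aff j) IH.
Qed.

(** Take a nonnegative direction. At a level at most 0, subtracting the level times [xi] only adds
    to its coordinates; at a level at least 1, it removes at least the coordinates of [xi], which
    dominate those of every root. Negation covers the other directions. *)
Lemma coef_sign f : aroot f ->
  (forall j, 0 <= coef f j) \/ (forall j, coef f j <= 0).
Proof.
have main g : aroot g -> nonneg_comb alpha g.1 ->
    (forall j, 0 <= coef g j) \/ (forall j, coef g j <= 0).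
  move=> [Pg /intrP[z zE]] g0.
  have [z0|z0] := leP z 0; [left|right] => j; rewrite /coef zE;
    case: unlift => [i|]; rewrite ?oppr_ge0 ?oppr_le0 ?lerz0 ?ler0z ?(ltW z0) //.
    rewrite subr_ge0; apply: le_trans (nonneg_comb_ge0 i g0).
    by rewrite mulr_le0_ge0 ?lerz0 // (le_trans ler01) ?xi_ge1.
  rewrite subr_le0; apply: le_trans (root_le_xi i Pg) _.
  by rewrite ler_peMl ?(le_trans ler01) ?xi_ge1 // ler1z.
move=> Pf; have [_ _ /(_ f.1)] := alpha_simple.
case: Pf => Pf Zf /(_ Pf) []; first exact: main.
move=> /(main (- f)) []; first exact: arootN.
  by move=> c0; right=> j; have := c0 j; rewrite coefN oppr_ge0.
by move=> c0; left=> j; have := c0 j; rewrite coefN oppr_le0.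
Qed.


(** * The base point of the fundamental alcove and positivity *)

Definition eps : R := (1 + \sum_i dot xi (omega i))^-1.

(* [(1 + ht xi)^-1] times the half sum of positive coroots: all the simple
   affine roots take the same value there. *)
Definition base_point : V := eps *: \sum_i omega i.

Lemma eps_gt0 : 0 < eps.
Proof.
rewrite invr_gt0 ltr_wpDr ?ltr01 // sumr_ge0 // => i _.
exact: le_trans ler01 (xi_ge1 i).
Qed.

Lemma ev_base_aff j : ev (aff j) base_point = eps.
Proof.
have [i ->|->] := unliftP ord0 j;
  rewrite ?affS ?aff0 /aff_eval /= dotZr dot_sumr.
  rewrite (bigD1 i) //= omega_coweights eqxx big1 ?addr0 ?mulr1 ?subr0 // => l.
  by rewrite eq_sym omega_coweights => /negPf->.
rewrite opprK -[X in _ + X](divff (lt0r_neq0 eps_gt0)).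
under eq_bigr do rewrite dotNl; rewrite sumrN.
rewrite -mulrDr -[RHS]mulr1; congr (_ * _).
by rewrite /eps invrK addrCA addNr addr0.
Qed.

Lemma ev_coef f x : ev f x = \sum_j coef f j * ev (aff j) x.
Proof.
rewrite /aff_eval -{1}(coef_sum1 f) dot_suml -{1}(coef_sum2 f) -sumrB.
by apply: eq_bigr => j _; rewrite dotZl mulrBr.
Qed.

Lemma ev_base f : ev f base_point = eps * \sum_j coef f j.
Proof.
rewrite ev_coef mulr_sumr; apply: eq_bigr => j _.
by rewrite ev_base_aff mulrC.
Qed.

(** Tested at one point; [positive_coef] and [coef_positive] show that for affine roots this means
    nonnegative coordinates. *)
Definition positive f := 0 < ev f base_point.

Lemma positive_aff j : positive (aff j).
Proof. by rewrite /positive ev_base_aff eps_gt0. Qed.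

Lemma positive_coef f : aroot f -> positive f -> forall j, 0 <= coef f j.
Proof.
move=> /coef_sign[//|f0]; rewrite /positive ev_base pmulr_rgt0 ?eps_gt0 //.
by move=> /lt_geF; rewrite sumr_le0.
Qed.

Lemma aroot_coef_neq0 f : aroot f -> exists j, coef f j != 0.
Proof.
move=> [/root_neq0 f0 _]; apply/existsP; apply: contraNT f0 => /existsPn c0.
rewrite -(coef_sum1 f) big1 // => j _.
by have /negbNE/eqP-> := c0 j; rewrite scale0r.
Qed.

Lemma coef_positive f : aroot f -> (forall j, 0 <= coef f j) -> positive f.
Proof.
move=> /aroot_coef_neq0[j cj] c0; rewrite /positive ev_base.
rewrite mulr_gt0 ?eps_gt0 // (bigD1 j) //= ltr_wpDr ?sumr_ge0 //.
by rewrite lt_def cj c0.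
Qed.

Lemma positiveN f : aroot f -> positive (- f) = ~~ positive f.
Proof.
move=> Pf; apply/idP/idP; rewrite /positive evN oppr_gt0.
  by move=> f0; rewrite -leNgt ltW.
case: (coef_sign Pf) => [/(coef_positive Pf)|c0].
  by rewrite /positive => ->.
move=> _; rewrite -oppr_gt0 -evN; apply: coef_positive; first exact: arootN.
by move=> j; rewrite coefN oppr_ge0.
Qed.

(** Since [Phi] is reduced, the ratio is 1 or -1, and -1 contradicts positivity. *)
Lemma root_prop_eq g f : aroot g -> aroot f -> positive g -> positive f ->
  forall c : R, (forall j, coef f j = c * coef g j) -> f = g.
Proof.
move=> Pg Pf g0 f0 c fc.
have f1 : f.1 = c *: g.1.
  rewrite -(coef_sum1 f) -(coef_sum1 g) scaler_sumr.
  by apply: eq_bigr => j _; rewrite fc scalerA.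
have f2 : f.2 = c * g.2.
  rewrite -(coef_sum2 f) -(coef_sum2 g) mulr_sumr.
  by apply: eq_bigr => j _; rewrite fc mulrA.
have [c1|c1] : c = 1 \/ c = -1.
  by case: Pf => Pf _; case: Pg => Pg _; apply: (root_scale Pg); rewrite -f1.
  case: f g f1 f2 {Pf Pg f0 g0 fc} => ? ? [? ?] /= -> ->.
  by rewrite c1 scale1r mul1r.
have : positive (- g).
  suff -> : - g = f by [].
  case: f g f1 f2 {Pf Pg f0 g0 fc} => ? ? [? ?] /= -> ->.
  by rewrite c1 scaleN1r mulN1r.
by rewrite positiveN // g0.
Qed.

(** The reflection changes only the coordinate at [j], so a positive root made negative has all its
    other coordinates zero. *)
Lemma simple_permutes j f :
  aroot f -> positive f -> ~~ positive (arefl dot (aff j) f) -> f = aff j.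
Proof.
move=> Pf f0 f'0; have Pj := aroot_aff j.
have Pf' := aroot_arefl Pj Pf.
apply: (@root_prop_eq _ _ Pj Pf (positive_aff j) f0 (coef f j)) => l.
rewrite coef_aff; have [<-|jl] := eqVneq j l; first by rewrite mulr1.
rewrite mulr0; apply/le_anti; rewrite positive_coef // andbT.
have := positive_coef (arootN Pf'); rewrite positiveN // => /(_ f'0 l).
by rewrite coefN oppr_ge0 coef_arefl coef_aff (negPf jl) mulr0 subr0.
Qed.

(** The exchange property: at some letter [l] the transported root turns from positive to negative,
    and by [simple_permutes] it is then [aff l]. *)
Lemma act_aff_neg u j : ~~ positive (act u (aff j)) ->
  exists u1 l u2, [/\ u = u1 ++ l :: u2, act u2 (aff j) = aff l
    & act u (aff j) = - act u1 (aff l)].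
Proof.
elim: u => [|b u IH] /=; first by rewrite positive_aff.
have [pu|nu] := boolP (positive (act u (aff j))).
  move=> /(simple_permutes (aroot_act u (aroot_aff j)) pu) E.
  by exists [::], b, u; split=> //=; rewrite E arefl_self // aff_neq0.
have [u1 [l [u2 [-> E1 E2]]]] := IH nu.
by move=> _; exists (b :: u1), l, u2; split=> //=; rewrite E2 areflN.
Qed.

(** Moved to the left past [u2], the final reflection becomes that of [l] and cancels it. *)
Lemma deletion u1 l u2 j : act u2 (aff j) = aff l ->
  word_prod (rcons (u1 ++ l :: u2) j) = word_prod (u1 ++ u2).
Proof.
move=> E; apply/funext => x.
rewrite -cats1 -catA !word_prod_cat /= !simple_reflE.
rewrite [word_prod u2 _]refl_act; last exact: aff_neq0.
by rewrite E reflK // aff_neq0.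
Qed.

(* The wall crossed at step [k] of the gallery of [u], as the affine root that
   is positive just before the crossing. *)
Definition beta u k : V * R := act (take k u) (aff (nth ord0 u k)).

Lemma aroot_beta u k : aroot (beta u k).
Proof. by apply: aroot_act; apply: aroot_aff. Qed.

Lemma ev_step u j f :
  ev f (word_prod (rcons u j) base_point) =
  ev (arefl dot (aff j) (act (rev u) f)) base_point.
Proof.
rewrite -cats1 word_prod_cat -[in LHS](act_revK dot aff_neq0 (rev u) f) revK.
rewrite ev_act; last exact: aff_neq0.
by rewrite ev_arefl /= simple_reflE.
Qed.

Lemma ev_word u f :
  ev f (word_prod u base_point) = ev (act (rev u) f) base_point.
Proof.
rewrite -[in LHS](act_revK dot aff_neq0 (rev u) f) revK ev_act //.
exact: aff_neq0.
Qed.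

(** Consecutive alcoves of a gallery are separated by a single wall; pulled back to the base alcove,
    this is [simple_permutes]. *)
Lemma crossing_last u j f : aroot f ->
  0 < ev f (word_prod u base_point) ->
  ~~ (0 < ev f (word_prod (rcons u j) base_point)) -> f = act u (aff j).
Proof.
move=> Pf; rewrite ev_word ev_step => f0 f1.
rewrite -(simple_permutes _ f0 f1); last exact: aroot_act.
by rewrite -{1}(revK u) (act_revK dot aff_neq0).
Qed.

Lemma crossing u f : aroot f -> positive f ->
  ~~ (0 < ev f (word_prod u base_point)) ->
  exists2 k, (k < size u)%N & f = beta u k.
Proof.
move=> Pf f0; elim/last_ind: u => [|u j IH].
  by rewrite /= -/(positive f) f0.
have [pu|/IH[k ku ->] _] := boolP (0 < ev f (word_prod u base_point)).
  move=> /(crossing_last Pf pu) ->; exists (size u); first by rewrite size_rcons.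
  by rewrite /beta -cats1 take_size_cat // nth_cat ltnn subnn.
exists k; first by rewrite size_rcons ltnW.
by rewrite /beta -cats1 takel_cat ?(ltnW ku) // nth_cat ku.
Qed.

(** * Reduced words and inversion sets *)

Local Notation reduced := (reduced dot alpha xi).
Local Notation infinite_reduced := (infinite_reduced dot alpha xi).
Local Notation Inv := (Defs.Inv dot alpha xi).

(** At a negative wall, [deletion] would remove two letters from the word. *)
Lemma reduced_beta u k : reduced u -> (k < size u)%N -> positive (beta u k).
Proof.
move=> ru ku; apply/negPn/negP => /act_aff_neg[u1 [l [u2 [Eu E _]]]].
have Ew : word_prod (u1 ++ u2 ++ drop k.+1 u) = word_prod u.
  apply/funext => x; rewrite -[in RHS](cat_take_drop k.+1 u).
  rewrite (take_nth ord0) // Eu catA [LHS]word_prod_cat [RHS]word_prod_cat.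
  by rewrite deletion.
have := ru _ Ew; have := congr1 size Eu.
by rewrite size_take ku !size_cat /= size_drop; lia.
Qed.

(** Images of the base point lie on no wall, so failing to be positive there means being
    negative. *)
Lemma ev_word_neq0 u f : aroot f ->
  ~~ (0 < ev f (word_prod u base_point)) ->
  0 < ev (- f) (word_prod u base_point).
Proof.
move=> Pf; rewrite !ev_word actN => f0.
by have := positiveN (aroot_act (rev u) Pf); rewrite /positive f0.
Qed.

Lemma beta_uncrossed u k : 0 < ev (beta u k) (word_prod (take k u) base_point).
Proof. by rewrite /beta ev_act ?ev_base_aff ?eps_gt0 //; exact: aff_neq0. Qed.

Section PositiveWord.
Variable u : seq 'I_n.+1.
Hypothesis u_pos : forall k, (k < size u)%N -> positive (beta u k).

(** A wall already crossed is not crossed back: the root of the returning step would be [- f], which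
    is not positive. *)
Lemma uncrossed m f : aroot f -> positive f -> (m < size u)%N ->
  ~~ (0 < ev f (word_prod (take m u) base_point)) ->
  ~~ (0 < ev f (word_prod (take m.+1 u) base_point)).
Proof.
move=> Pf f0 mu fm; apply/negP => fm1.
have E := crossing_last (arootN Pf) (ev_word_neq0 Pf fm) (j := nth ord0 u m).
have := u_pos mu; rewrite /beta -E.
  by rewrite positiveN // f0.
by rewrite -take_nth // evN oppr_gt0 -leNgt ltW.
Qed.

Lemma stays_crossed m p f : aroot f -> positive f -> (m <= p <= size u)%N ->
  ~~ (0 < ev f (word_prod (take m u) base_point)) ->
  ~~ (0 < ev f (word_prod (take p u) base_point)).
Proof.
move=> Pf f0 /andP[mp]; rewrite -(subnKC mp); elim: (p - m)%N => [|q IH] qu fm.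
  by rewrite addn0.
by rewrite addnS; apply: uncrossed => //; [lia | apply: IH => //; lia].
Qed.

Lemma beta_crossed k p : (k < p <= size u)%N ->
  ~~ (0 < ev (beta u k) (word_prod (take p u) base_point)).
Proof.
move=> /andP[kp pu]; have ku := leq_trans kp pu.
apply: (@stays_crossed k.+1) => //; [exact: aroot_beta|exact: u_pos|lia|].
rewrite (take_nth ord0) // /beta -cats1 word_prod_cat ev_act;
  last exact: aff_neq0.
rewrite /= simple_reflE -ev_arefl arefl_self ?aff_neq0 // evN ev_base_aff.
by rewrite oppr_gt0 -leNgt ltW // eps_gt0.
Qed.

Lemma beta_inj : {in [pred k | (k < size u)%N] &, injective (beta u)}.
Proof.
have main k l : (k < l < size u)%N -> beta u k <> beta u l.
  move=> /andP[kl lu] E; have := beta_uncrossed u l; rewrite -E => E0.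
  by have := @beta_crossed k l; rewrite kl ltnW // E0 => /(_ isT).
move=> k l; rewrite !inE => ku lu E; case: (ltngtP k l) => // kl.
  by case: (main k l); rewrite // kl.
by case: (main l k); rewrite // kl.
Qed.

(** Any word [v] for the same element ends at the same point, so its gallery crosses all the
    distinct walls [beta u k] and needs at least as many letters. *)
Lemma positive_reduced : reduced u.
Proof.
move=> v vu; pose B w := [seq beta w k | k <- iota 0 (size w)].
have uB : uniq (B u).
  rewrite map_inj_in_uniq ?iota_uniq // => k l; rewrite !mem_iota /= !add0n.
  exact: beta_inj.
have := uniq_leq_size uB (s2 := B v); rewrite !size_map !size_iota; apply.
move=> f /mapP[k]; rewrite mem_iota add0n => /= ku ->.
have [] := @crossing v (beta u k); first exact: aroot_beta.
- exact: u_pos.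
- by rewrite vu -{2}(take_size u) beta_crossed // ku leqnn.
by move=> l lv ->; apply: map_f; rewrite mem_iota.
Qed.

End PositiveWord.

(** * Walls crossed by infinite words *)

Section InfiniteWords.
Implicit Types i : infinite_word n.

Definition ibeta i k : V * R := act (mkseq i k) (aff (i k)).

Lemma aroot_ibeta i k : aroot (ibeta i k).
Proof. by apply: aroot_act; apply: aroot_aff. Qed.

Lemma take_mkseq i k m : (k <= m)%N -> take k (mkseq i m) = mkseq i k.
Proof. by move=> km; rewrite /mkseq -map_take take_iota (minn_idPl km). Qed.

Lemma beta_mkseq i k m : (k < m)%N -> beta (mkseq i m) k = ibeta i k.
Proof.
by move=> km; rewrite /beta take_mkseq ?nth_mkseq // ltnW.
Qed.

Lemma infinite_reducedP i :
  infinite_reduced i <-> forall k, positive (ibeta i k).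
Proof.
split=> [ri k|pi m].
  by rewrite -(@beta_mkseq i k k.+1) // reduced_beta // size_mkseq.
by apply: positive_reduced => k; rewrite size_mkseq => /beta_mkseq ->.
Qed.

(** The exchange position is an earlier step that crossed the same wall the other way. *)
Lemma ibeta_neg i k : ~~ positive (ibeta i k) ->
  exists2 l, (l < k)%N & ibeta i k = - ibeta i l.
Proof.
rewrite {2}/ibeta => /act_aff_neg[u1 [l [u2 [E _ ->]]]].
have ku : (size u1 < k)%N.
  by have := congr1 size E; rewrite size_mkseq size_cat /=; lia.
exists (size u1) => //; congr (- act _ (aff _)).
  have := congr1 (take (size u1)) E.
  by rewrite take_size_cat // take_mkseq // ltnW.
have := congr1 (fun s => nth ord0 s (size u1)) E.
by rewrite /= nth_mkseq // nth_cat ltnn subnn.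
Qed.

Lemma crossed_ibeta i f : infinite_reduced i -> aroot f -> positive f ->
  (exists k, f = ibeta i k) <->
  exists m, ~~ (0 < ev f (word_prod (mkseq i m) base_point)).
Proof.
move=> /infinite_reducedP pi Pf f0; split=> [[k ->]|[m]].
  exists k.+1; rewrite -(@beta_mkseq i k k.+1) //.
  rewrite -{2}(take_size (mkseq i k.+1)) beta_crossed // size_mkseq ?ltnSn //.
  by move=> l lk; rewrite beta_mkseq.
move=> /(crossing Pf f0)[k]; rewrite size_mkseq => km ->.
by exists k; rewrite beta_mkseq.
Qed.

Lemma ibeta_inj i : infinite_reduced i -> injective (ibeta i).
Proof.
move=> /infinite_reducedP pi k l.
pose m := (maxn k l).+1; have [km lm] : (k < m)%N /\ (l < m)%N by lia.
rewrite -(beta_mkseq i km) -(beta_mkseq i lm).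
apply: beta_inj; rewrite ?inE ?size_mkseq // => p pm.
by rewrite beta_mkseq.
Qed.

Lemma InvP i t : Inv i t <->
  exists k, t = refl dot (ibeta i k).1 (ibeta i k).2.
Proof.
have E k : word_prod (mkseq i k ++ i k :: rev (mkseq i k)) =
    refl dot (ibeta i k).1 (ibeta i k).2.
  by apply: word_prod_refl; exact: aff_neq0.
by split=> -[k ->]; exists k; rewrite ?E.
Qed.

Lemma scaler_injr v (c d : R) : v != 0 -> c *: v = d *: v -> c = d.
Proof.
move=> v0 /eqP; rewrite -subr_eq0 -scalerBl scaler_eq0 (negPf v0) orbF subr_eq0.
by move=> /eqP.
Qed.

(** Equal reflections have equal linear parts, so their directions agree up to sign, and the value
    at 0 fixes the level. Thus [Inv] amounts to a set of positive affine roots. *)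
Lemma refl_inj f g : aroot f -> aroot g -> positive f -> positive g ->
  refl dot f.1 f.2 = refl dot g.1 g.2 -> f = g.
Proof.
move=> [Pf Zf] [Pg Zg] f0 g0 E.
have E1 x : refl dot f.1 0 x = refl dot g.1 0 x.
  by rewrite -[x]subr0 -(reflB dot _ f.2) -(reflB dot _ g.2) E.
have [t ft] : exists t : R, f.1 = t *: g.1.
  exists (cartan dot f.1 g.1 / 2); have := E1 f.1.
  rewrite !refl0E cartan_self ?root_neq0 // => /(congr1 (fun z => f.1 - z)).
  rewrite !opprB !(addrC f.1) !subrK => E2.
  by rewrite mulrC -scalerA -E2 scalerA mulVf ?scale1r // pnatr_eq0.
have {E} := congr1 (fun h => h 0) E.
have fE : f = (f.1, f.2) by case: (f).
have gE : g = (g.1, g.2) by case: (g).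
have nz : 2 / dot g.1 g.1 != 0.
  by rewrite mulf_neq0 ?invr_eq0 ?pnatr_eq0 ?dot_eq0 ?root_neq0.
have [t1|t1] : t = 1 \/ t = -1 by apply: (root_scale Pg); rewrite -ft.
  rewrite ft t1 scale1r !reflE !dot0l !sub0r => /oppr_inj.
  move=> /(scaler_injr (root_neq0 Pg)) /(mulIf nz) /oppr_inj f2.
  by rewrite fE gE ft t1 scale1r f2.
have ft' : f.1 = - g.1 by rewrite ft t1 scaleN1r.
rewrite -[f.2]opprK ft' reflN !reflE !dot0l !sub0r => /oppr_inj.
move=> /(scaler_injr (root_neq0 Pg)) /(mulIf nz) /oppr_inj f2.
have fg : - g = f by rewrite fE ft' -[f.2]opprK f2.
by have := @positiveN g (conj Pg Zg); rewrite fg f0 g0.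
Qed.

Lemma Inv_refl i f : infinite_reduced i -> aroot f -> positive f ->
  Inv i (refl dot f.1 f.2) <-> exists k, f = ibeta i k.
Proof.
move=> /infinite_reducedP pi Pf f0; split.
  move=> /InvP[k /refl_inj E]; exists k; apply: E => //; exact: aroot_ibeta.
by move=> [k ->]; apply/InvP; exists k.
Qed.

(** * Periodic words *)

Definition directed v i := forall k, dot (ibeta i k).1 v < 0.

Lemma directed_reduced v i : directed v i -> infinite_reduced i.
Proof.
move=> di; apply/infinite_reducedP => k; apply/negPn/negP => /ibeta_neg[l _ E].
by have := di k; rewrite E /= dotNl oppr_lt0 ltNge ltW.
Qed.

Definition power u m : seq 'I_n.+1 := flatten (nseq m u).

Lemma size_power u m : size (power u m) = (m * size u)%N.
Proof. by rewrite size_flatten /shape map_nseq sumn_nseq mulnC. Qed.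

Lemma mkseq_repeat u m l : (l < size u)%N ->
  mkseq (infinite_repeat u) (m * size u + l) = power u m ++ take l u.
Proof.
move=> lu; elim: m => [|m IH].
  rewrite mul0n add0n /=; apply: (@eq_from_nth _ ord0).
    by rewrite size_mkseq size_takel // ltnW.
  move=> k; rewrite size_mkseq => kl.
  rewrite nth_mkseq // /infinite_repeat nth_take //.
  by rewrite modn_small // (ltn_trans kl).
rewrite mulSn -addnA /mkseq iotaD map_cat /= -catA; congr (_ ++ _).
  apply: (@eq_from_nth _ ord0); rewrite size_map size_iota // => k ku.
  by rewrite (nth_map 0%N) ?size_iota // nth_iota // /infinite_repeat modn_small.
rewrite -IH add0n -[X in iota X _]addn0 iotaDl -map_comp; apply: eq_map => k /=.
by rewrite /infinite_repeat modnDl.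
Qed.

Lemma mkseq_repeat_power u m : (0 < size u)%N ->
  mkseq (infinite_repeat u) (m * size u) = power u m.
Proof. by move=> /(mkseq_repeat m); rewrite addn0 take0 cats0. Qed.

Lemma lin_power u m v : lin u v = v -> lin (power u m) v = v.
Proof. by move=> uv; elim: m => //= m IH; rewrite lin_cat IH uv. Qed.

(** Each wall is one of the first period moved by a power of [u], whose linear part fixes [v]; so
    one period is enough. *)
Lemma repeat_directed u v : (0 < size u)%N -> lin u v = v ->
  (forall l, (l < size u)%N -> dot (beta u l).1 v < 0) ->
  directed v (infinite_repeat u).
Proof.
move=> u0 uv du k; have lu := ltn_pmod k u0.
rewrite (divn_eq k (size u)) /ibeta mkseq_repeat // /infinite_repeat.
rewrite modnMDl modn_mod act_cat act_fst.
by rewrite -{1}(lin_power (k %/ size u) uv) lin_isom du.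
Qed.

Lemma word_prod_power u w m : word_prod u = word_prod w ->
  word_prod (power u m) = word_prod (power w m).
Proof.
move=> uw; elim: m => //= m IH; apply/funext => x.
by rewrite !word_prod_cat uw IH.
Qed.

(** Crossed walls stay crossed, so only the ends of periods matter. These depend on the element
    [word_prod u] alone, which makes the limit class independent of the reduced word. *)
Lemma crossed_power u f :
  (0 < size u)%N -> infinite_reduced (infinite_repeat u) -> aroot f ->
  positive f ->
  (exists k, f = ibeta (infinite_repeat u) k) <->
  exists m, ~~ (0 < ev f (word_prod (power u m) base_point)).
Proof.
move=> u0 ru Pf f0; split=> [[k ->]|[m fm]].
  have km : (k < k.+1 * size u)%N by rewrite leq_pmulr.
  exists k.+1; rewrite -mkseq_repeat_power // -(beta_mkseq _ km).
  rewrite -{2}(take_size (mkseq _ _)) beta_crossed ?size_mkseq ?km ?leqnn //.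
  by move=> l lm; rewrite beta_mkseq //; move/infinite_reducedP: ru; apply.
apply/(crossed_ibeta ru Pf f0); exists (m * size u)%N.
by rewrite mkseq_repeat_power.
Qed.

Lemma reduced_size u w : reduced u -> reduced w -> word_prod u = word_prod w ->
  size u = size w.
Proof. by move=> ru rw uw; apply/eqP; rewrite eqn_leq ru ?rw. Qed.

Lemma repeat_reduced_eq u w : (0 < size u)%N -> reduced u -> reduced w ->
  word_prod u = word_prod w -> infinite_reduced (infinite_repeat u) ->
  infinite_reduced (infinite_repeat w).
Proof.
move=> u0 ru rw uw ri; have E := reduced_size ru rw uw.
apply/infinite_reducedP => k.
have km : (k < k.+1 * size w)%N by rewrite leq_pmulr // -E.
rewrite -(beta_mkseq _ km); apply: reduced_beta; last by rewrite size_mkseq.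
move=> v; rewrite mkseq_repeat_power -?E // -(word_prod_power _ uw).
by rewrite -mkseq_repeat_power // => /ri; rewrite size_mkseq size_power -E.
Qed.

Lemma Inv_subset i i' : infinite_reduced i -> infinite_reduced i' ->
  (forall f, aroot f -> positive f -> (exists k, f = ibeta i k) ->
     exists k, f = ibeta i' k) -> (Inv i `<=` Inv i')%classic.
Proof.
move=> /infinite_reducedP pi _ ij t /InvP[k ->].
have [|l ->] := ij _ (aroot_ibeta i k) (pi k); first by exists k.
by apply/InvP; exists l.
Qed.

Lemma Inv_eq i i' : infinite_reduced i -> infinite_reduced i' ->
  (forall f, aroot f -> positive f -> (exists k, f = ibeta i k) <->
     exists k, f = ibeta i' k) -> Inv i = Inv i'.
Proof.
move=> ri ri' ij; apply/seteqP; split; apply: Inv_subset => // f Pf f0.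
  by move/(ij f Pf f0).
by move/(ij f Pf f0).
Qed.

Lemma limit_class_eq i i' : Inv i = Inv i' ->
  limit_class dot alpha xi i = limit_class dot alpha xi i'.
Proof. by move=> ij; rewrite /limit_class ij. Qed.

Lemma limit_powerE u : (0 < size u)%N -> reduced u ->
  infinite_reduced (infinite_repeat u) ->
  limit_power dot alpha xi (word_prod u) =
  limit_class dot alpha xi (infinite_repeat u).
Proof.
move=> u0 ru ri; apply/seteqP; split=> [i [w [rw wu iw]]|i iu]; last by exists u.
suff -> : limit_class dot alpha xi (infinite_repeat u) =
  limit_class dot alpha xi (infinite_repeat w) by [].
have w0 : (0 < size w)%N by rewrite (reduced_size rw ru wu).
have rw' := repeat_reduced_eq u0 ru rw (esym wu) ri.
apply/limit_class_eq/Inv_eq => // f Pf f0; split.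
  move=> /(crossed_power u0 ri Pf f0)[m fm].
  apply/(crossed_power w0 rw' Pf f0); exists m.
  by rewrite (word_prod_power m wu).
move=> /(crossed_power w0 rw' Pf f0)[m fm].
apply/(crossed_power u0 ri Pf f0); exists m.
by rewrite -(word_prod_power m wu).
Qed.

End InfiniteWords.

(** * Finite Weyl group *)

(** The positive number [dot f.1 f.1], expanded in the affine simple roots, has a positive term;
    integrality raises its Cartan number to at least 1. *)
Lemma descent f : aroot f -> positive f ->
  exists j, [/\ 0 < coef f j & 1 <= cartan dot f.1 (aff j).1].
Proof.
move=> Pf f0; have c0 := positive_coef Pf f0.
have [j cj dj] : exists2 j, 0 < coef f j & 0 < dot f.1 (aff j).1.
  have f1 : 0 < dot f.1 f.1 by apply: dot_gt0; case: Pf => /root_neq0.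
  apply: contrapT => noj; move: f1; apply/negP; rewrite -leNgt.
  rewrite -{2}(coef_sum1 f) dot_sumr sumr_le0 // => j _; rewrite dotZr.
  have [cj|cj] := ltP 0 (coef f j); last first.
    by rewrite (_ : coef f j = 0) ?mul0r //; apply/le_anti; rewrite cj c0.
  by rewrite pmulr_rle0 // leNgt; apply/negP => dj; apply: noj; exists j.
exists j; split=> //.
have : 0 < cartan dot f.1 (aff j).1.
  by rewrite /cartan mulr_gt0 // divr_gt0 ?ltr0n ?dot_gt0 ?aff_neq0.
have := cartan_int (aroot_aff j).1 Pf.1; move=> /intrP[z ->].
by rewrite ltr0z ler1z.
Qed.

(** Reflecting at a descent lowers the value at the base point by at least [eps], so the process
    reaches a simple root. At level 0 the affine coordinate is 0, hence the affine letter is never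
    chosen; this yields the finite Weyl group as well. *)
Lemma aroot_orbit f : aroot f -> positive f ->
  exists u j, f = act u (aff j) /\ (f.2 = 0 -> ord0 \notin j :: u).
Proof.
move=> Pf f0.
have [N] : exists N, ev f base_point < eps * N%:R.
  exists (Num.bound (ev f base_point / eps)).
  rewrite mulrC -ltr_pdivrMr ?eps_gt0 //; apply: archi_boundP.
  by rewrite ltW // divr_gt0 ?eps_gt0.
elim: N f Pf f0 => [|N IH] f Pf f0 fN.
  by move: fN; rewrite mulr0 ltNge ltW.
have [j [cj dj]] := descent Pf f0.
have j0 : f.2 = 0 -> j != ord0.
  by move=> f2; apply: contraTneq cj => ->; rewrite coef0 f2 oppr0 ltxx.
have [pf'|nf'] := boolP (positive (arefl dot (aff j) f)); last first.
  have E := simple_permutes Pf f0 nf'; exists [::], j; split=> // /j0.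
  by rewrite inE eq_sym.
have [|u [l [E ul]]] := IH _ (aroot_arefl (aroot_aff j) Pf) pf'.
  move: fN; rewrite /aff_eval /= dotDl dotNl dotZl => fN.
  have := ev_base_aff j; rewrite /aff_eval => Ej.
  have : eps <= cartan dot f.1 (aff j).1 * eps.
    by rewrite ler_peMl // ltW ?eps_gt0.
  rewrite -{2}Ej; rewrite -natr1 in fN; lra.
exists (j :: u), l; split; first by rewrite /= -E areflK // aff_neq0.
move=> f2; have := j0 f2; move: ul; rewrite /= f2.
have -> : (aff j).2 = 0.
  by have := j0 f2; case: (unliftP ord0 j) => [i ->|->]; rewrite ?affS ?eqxx.
rewrite mulr0 subr0 => /(_ erefl); rewrite !inE !negb_or eq_sym => /andP[-> ->].
by rewrite eq_sym => ->.
Qed.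

Lemma word_refl f : aroot f -> exists u, word_prod u = refl dot f.1 f.2.
Proof.
move=> Pf; wlog f0 : f Pf / positive f => [wl|].
  have [/(wl f Pf)//|nf] := boolP (positive f).
  have [||u E] := wl (- f); [exact: arootN|by rewrite positiveN|exists u].
  by rewrite E; apply/funext => x; rewrite /= reflN.
have [u [j [-> _]]] := aroot_orbit Pf f0.
by exists (u ++ j :: rev u); apply: word_prod_refl; exact: aff_neq0.
Qed.

Implicit Types (i l : 'I_n).

Definition finite_word u := ord0 \notin u.

Lemma finite_cons j u : finite_word (j :: u) = (j != ord0) && finite_word u.
Proof. by rewrite /finite_word inE negb_or eq_sym. Qed.

Lemma finite_cat u1 u2 :
  finite_word (u1 ++ u2) = finite_word u1 && finite_word u2.
Proof. by rewrite /finite_word mem_cat negb_or. Qed.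

Lemma finite_rev u : finite_word (rev u) = finite_word u.
Proof. by rewrite /finite_word mem_rev. Qed.

Lemma aff_snd0 j : j != ord0 -> (aff j).2 = 0.
Proof. by case: (unliftP ord0 j) => [i ->|->]; rewrite ?affS ?eqxx. Qed.

Lemma word_prod_finite u : finite_word u -> word_prod u =1 lin u.
Proof.
elim: u => //= j u IH; rewrite finite_cons => /andP[j0 u0] x.
by rewrite /= simple_reflE aff_snd0 // IH.
Qed.

Lemma act_finite u a : finite_word u -> act u (a, 0) = (lin u a, 0).
Proof.
elim: u => //= j u IH; rewrite finite_cons => /andP[j0 /IH ->].
by rewrite /arefl /= aff_snd0 // mulr0 subr0 refl0E.
Qed.

Lemma aroot_level0 a : a \in Phi -> aroot (a, 0).
Proof. by split; rewrite ?rpred0. Qed.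

Lemma finite_refl a : a \in Phi ->
  exists2 u, finite_word u & lin u =1 refl dot a 0.
Proof.
move=> Pa; wlog a0 : a Pa / positive (a, 0) => [wl|].
  have [/(wl a Pa)//|na] := boolP (positive (a, 0)).
  have E : (- a, 0) = - (a, 0) :> V * R by congr pair; rewrite /= oppr0.
  have [||u fu uE] := wl (- a); rewrite ?rootN //.
    by rewrite E positiveN //; exact: aroot_level0.
  by exists u => // x; rewrite uE -[X in refl _ _ X _]oppr0 reflN.
have [u [j [E]]] := aroot_orbit (aroot_level0 Pa) a0.
move=> /(_ erefl); rewrite -/(finite_word _) finite_cons => /andP[j0 fu].
have fin : finite_word (u ++ j :: rev u).
  by rewrite finite_cat finite_cons finite_rev j0 fu.
exists (u ++ j :: rev u) => // x; rewrite -word_prod_finite //.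
by rewrite word_prod_refl -?E //; exact: aff_neq0.
Qed.

(** On directions the affine letter acts as the reflection in [xi], which is a product of simple
    reflections. *)
Lemma lin_finite u : exists2 u', finite_word u' & lin u' =1 lin u.
Proof.
elim: u => [|j u [w fw E]]; first by exists [::].
have [v fv Ev] := finite_refl (aroot_aff j).1.
exists (v ++ w); first by rewrite finite_cat fv.
by move=> x; rewrite lin_cat Ev E.
Qed.

Lemma lin_root u a : a \in Phi -> lin u a \in Phi.
Proof.
by move=> Pa; elim: u => //= j u IH; apply: root_refl (aroot_aff j).1 IH.
Qed.

Lemma weyl_lin w : weyl_group dot Phi w -> exists u, lin u =1 w.
Proof.
move=> [bs [sub ->]]; elim: bs sub => [|b bs IH] sub; first by exists [::].
have [|u uE] := IH; first by move=> c cbs; apply: sub; rewrite inE cbs orbT.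
have [|v _ vE] := @finite_refl b; first by apply: sub; rewrite inE eqxx.
by exists (v ++ u) => x; rewrite lin_cat vE uE.
Qed.

Lemma lin_weyl u : weyl_group dot Phi (lin u).
Proof.
exists [seq (aff j).1 | j <- u]; split.
  by move=> _ /mapP[j _ ->]; case: (aroot_aff j).
by apply/funext => x; elim: u => //= j u ->.
Qed.

(** * The dominant chamber and stabilizers *)

Definition dominant x := forall i, 0 <= dot (alpha i) x.

Lemma level0_positiveP a : a \in Phi ->
  positive (a, 0) -> forall i, 0 <= dot a (omega i).
Proof.
move=> Pa a0 i; have := positive_coef (aroot_level0 Pa) a0 (lift ord0 i).
by rewrite coefS /= mul0r subr0.
Qed.

Lemma dominant_root x a : dominant x -> a \in Phi -> positive (a, 0) ->
  0 <= dot a x.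
Proof.
move=> dx Pa /(level0_positiveP Pa) a0.
rewrite (coweight_expand a) dot_suml sumr_ge0 // => i _.
by rewrite dotZl mulr_ge0.
Qed.

Lemma lin1 i x : lin [:: lift ord0 i] x = refl dot (alpha i) 0 x.
Proof. by rewrite /= affS. Qed.

Lemma simple_permutes_level0 i a : a \in Phi -> positive (a, 0) ->
  a != alpha i -> positive (refl dot (alpha i) 0 a, 0).
Proof.
move=> Pa a0; apply: contraNT => na; apply/eqP.
have E := simple_permutes (j := lift ord0 i) (aroot_level0 Pa) a0.
suff /E : ~~ positive (arefl dot (aff (lift ord0 i)) (a, 0)).
  by rewrite affS => -[].
by rewrite affS /arefl /= mulr0 subr0 -refl0E.
Qed.

(** Reflecting in a simple root negative on [x] lowers the number of positive roots negative on [x]: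
    that simple root leaves the set and the other positive roots are permuted. *)
Lemma dominate x : exists2 u, finite_word u & dominant (lin u x).
Proof.
pose neg y := [seq a <- Phi | positive (a, 0) && (dot a y < 0)].
have [N] := ubnP (size (neg x)); elim: N x => // N IH x xN.
have [|] := pselect (dominant x); first by exists [::].
move=> /existsNP[i] /negP; rewrite -ltNge => ix.
pose y := refl dot (alpha i) 0 x.
have yx : (size (neg y) < size (neg x))%N.
  have uy : uniq (alpha i :: map (refl dot (alpha i) 0) (neg y)).
    rewrite /= map_inj_uniq; last exact: inv_inj (refl0K dot (alpha i)).
    rewrite filter_uniq ?fset_uniq // andbT; apply/negP => /mapP[a].
    rewrite mem_filter => /andP[/andP[a0 _] Pa] /(congr1 (refl dot (alpha i) 0)).
    rewrite refl0K refl0E cartan_self ?(root_neq0 (alpha_root i)) // => E.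
    have {E}E : (a, 0) = - (aff (lift ord0 i)).
      rewrite affS; congr pair; rewrite /= ?oppr0 // -E scaler_nat mulr2n.
      by rewrite opprD addrA subrr sub0r.
    by move: a0; rewrite E positiveN ?positive_aff //; exact: aroot_aff.
  have := uniq_leq_size uy (s2 := neg x); rewrite /= size_map; apply.
  move=> b; rewrite inE => /orP[/eqP ->|/mapP[a]].
    rewrite mem_filter ix alpha_root !andbT.
    by have := positive_aff (lift ord0 i); rewrite affS.
  rewrite !mem_filter => /andP[/andP[a0 ay] Pa] ->.
  rewrite root_refl ?alpha_root // andbT refl_adj ay andbT.
  apply: simple_permutes_level0 => //; apply: contraTneq ay => ->.
  by rewrite /y -refl_adj refl0E cartan_self ?(root_neq0 (alpha_root i)) //
    !dotE; lra.
have [|u fu du] := IH y; first exact: leq_trans yx xN.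
exists (rcons u (lift ord0 i)).
  by rewrite -cats1 finite_cat fu finite_cons.
by rewrite -cats1 lin_cat lin1.
Qed.

(* The last letter of [u] either fixes [x] or can be cancelled by deletion. *)
Lemma dominant_stab u x v : finite_word u -> dominant x -> dominant (lin u x) ->
  (forall i, dot (alpha i) x = 0 -> dot (alpha i) v = 0) -> lin u v = v.
Proof.
move=> + dx + xv; have [N] := ubnP (size u); elim: N u => // N IH.
case/lastP => // u j; rewrite size_rcons ltnS => uN.
rewrite -cats1 finite_cat finite_cons => /and3P[fu j0 _].
have [i jE|jE] := unliftP ord0 j; last by rewrite jE eqxx in j0.
rewrite {j j0}jE !lin_cat !lin1 => dux.
have fixed z : dot (alpha i) z = 0 -> refl dot (alpha i) 0 z = z.
  by move=> iz; rewrite reflE dotC iz subrr mul0r scale0r subr0.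
have [ix|ix] := eqVneq (dot (alpha i) x) 0.
  by move: dux; rewrite !fixed ?xv //; apply: IH.
have Pa : lin (u ++ [:: lift ord0 i]) (alpha i) \in Phi.
  by rewrite lin_root ?alpha_root.
have fui : finite_word (u ++ [:: lift ord0 i]).
  by rewrite finite_cat fu finite_cons.
(* The image of [alpha i] pairs with the dominant image of [x] to [dot (alpha i) x], which is
   positive here, so it is a positive root. Then [u] makes [alpha i] negative and the exchange
   property applies. *)
have pa : positive (lin (u ++ [:: lift ord0 i]) (alpha i), 0).
  apply/negPn/negP => na.
  have E : (- lin (u ++ [:: lift ord0 i]) (alpha i), 0) =
    - (lin (u ++ [:: lift ord0 i]) (alpha i), 0) :> V * R.
    by congr pair; rewrite /= oppr0.
  have := dominant_root dux (rootN Pa).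
  rewrite E positiveN; last exact: aroot_level0.
  move=> /(_ na); rewrite -lin1 -lin_cat dotNl lin_isom oppr_ge0 => ix0.
  by case/eqP: ix; apply/le_anti; rewrite ix0 dx.
have nu : ~~ positive (act u (aff (lift ord0 i))).
  have := aroot_act u (aroot_aff (lift ord0 i)) => Pu.
  rewrite -positiveN // -actN -(arefl_self dot (aff_neq0 _)).
  rewrite -[arefl _ _ _]/(act [:: lift ord0 i] (aff (lift ord0 i))) -act_cat affS.
  by rewrite act_finite.
have [u1 [l [u2 [uE E _]]]] := act_aff_neg nu.
have {E}Ew : lin (u1 ++ u2) =1 lin (u ++ [:: lift ord0 i]).
  move=> z; rewrite -[z]subr0 -!(word_prodB dot alpha xi) cats1 uE.
  by rewrite (deletion u1 E).
rewrite -!lin1 -!lin_cat -Ew; apply: IH.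
- by move: uN; rewrite uE !size_cat /=; lia.
- by move: fu; rewrite uE !finite_cat finite_cons => /and3P[-> _ ->].
- by rewrite Ew lin_cat lin1.
Qed.

(** * Minimality along a ray *)

Lemma coweight_expand_lin u x :
  x = \sum_i dot x (lin u (omega i)) *: lin u (alpha i).
Proof.
rewrite -{1}(lin_Krev dot alpha xi u x).
rewrite {1}(coweight_expand (lin (rev u) x)) lin_sum.
by apply: eq_bigr => i _; rewrite linZ lin_adj revK.
Qed.

Lemma coef0_positive f : aroot f -> 0 < coef f ord0 -> positive f.
Proof.
move=> Pf c0; case: (coef_sign Pf) => [/(coef_positive Pf)//|].
by move=> /(_ ord0)/le_gtF/negP.
Qed.

(** There are finitely many roots and finitely many integer levels in a bounded range; used to show
    that a bounded gallery crosses finitely many walls. *)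
Lemma aroot_level_bound (K : R) (A : V * R -> Prop) :
  (forall f, A f -> aroot f /\ `|f.2| <= K) ->
  exists T : seq (V * R), forall f, A f -> f \in T.
Proof.
move=> AK; have [N KN] : exists N, K < N%:R.
  by exists (Num.bound `|K|); apply: le_lt_trans (ler_norm K) (archi_boundP _).
exists [seq (a, p%:R - N%:R) | a <- Phi, p <- iota 0 (2 * N).+1].
move=> f /AK[[Pf /intrP[z zE]] fK]; apply/allpairsP.
have : `|z| < N by rewrite -(ltr_int R) intr_norm -zE; apply: le_lt_trans KN.
move=> zN; exists (f.1, absz (z + N)); split; first exact: Pf.
  by rewrite mem_iota /=; lia.
case: f zE {Pf fK} => a t /= ->; congr pair.
have -> : (absz (z + N))%:R = (z + N)%:~R :> R.
  by rewrite natr_absz ger0_norm //; lia.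
by rewrite intrD; apply/esym/addrK.
Qed.

Section RayMinimality.
Variables (w : infinite_word n) (u : seq 'I_n.+1) (i : 'I_n).
Hypothesis w_reduced : infinite_reduced w.
Hypothesis w_directed : directed (lin u (omega i)) w.

Let pt m := word_prod (mkseq w m) base_point.

(** The wall of [(a, -1)] is positive at the base point, and a direction nonnegative on the ray is
    never crossed. *)
Lemma opposite_bounded a m : a \in Phi -> 0 <= dot a (lin u (omega i)) ->
  -1 < dot a (pt m).
Proof.
move=> Pa a0; have Pf : aroot (a, -1) by split; rewrite ?rpredN ?rpred1.
have f0 : positive (a, -1) by apply: coef0_positive; rewrite // coef0 /= opprK.
rewrite -subr_gt0 -[_ - _]/(ev (a, -1) (pt m)); apply/negPn/negP => fm.
have [|k fk] := (crossed_ibeta w_reduced Pf f0).2; first by exists m.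
by have := w_directed k; rewrite -fk /= ltNge a0.
Qed.

(* If some wall were never crossed, the gallery would stay bounded, although it
   crosses infinitely many walls. *)
Lemma ray_minimal f : aroot f -> positive f -> dot f.1 (lin u (omega i)) < 0 ->
  exists k, f = ibeta w k.
Proof.
move=> Pf f0 fneg; apply/(crossed_ibeta w_reduced Pf f0).
apply: contrapT => /forallNP nocross.
have {nocross}fx m : f.2 < dot f.1 (pt m).
  by have /negP/negPn := nocross m; rewrite subr_gt0.
(* The simple system moved by [u]: on the ray [g i] is positive and the other [g l] vanish. *)
pose g l := lin u (alpha l).
have Pg l : g l \in Phi by rewrite lin_root ?alpha_root.
have gw l : dot (g l) (lin u (omega i)) = (l == i)%:R.
  by rewrite lin_isom omega_coweights.
have lo l m : -1 < dot (g l) (pt m).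
  by apply: opposite_bounded => //; rewrite gw ler0n.
(* For [l != i] both [g l] and its opposite are nonnegative on the ray, so this coordinate is
   bounded on both sides. *)
have hi l m : l != i -> dot (g l) (pt m) < 1.
  move=> ji; rewrite -ltrN2 -dotNl; apply: opposite_bounded; rewrite ?rootN //.
  by rewrite dotNl gw (negPf ji) oppr0.
pose c a l := dot a (lin u (omega l)).
have expand a y : dot a y = \sum_l c a l * dot (g l) y.
  rewrite {1}(coweight_expand_lin u a) dot_suml.
  by apply: eq_bigr => l _; rewrite dotZl.
(* This solves [fx] for the coordinate along [g i], whose coefficient in [f.1] is negative; the
   other coordinates have absolute value at most 1. *)
pose K1 := (\sum_(l | l != i) `|c f.1 l| - f.2) / - c f.1 i.
have hi1 m : dot (g i) (pt m) < K1.
  rewrite ltr_pdivlMr ?oppr_gt0 // mulrN ltrNl opprB.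
  have := fx m; rewrite expand (bigD1 i) //= mulrC => /lt_le_trans fm.
  rewrite ltrBlDr; apply: fm; rewrite lerD2l; apply: ler_sum => l ji.
  apply: le_trans (ler_norm _) _; rewrite normrM ler_piMr //.
  by rewrite ler_norml ltW ?lo // ltW ?hi.
pose K2 := Num.max 1 K1.
have gK2 l m : `|dot (g l) (pt m)| <= K2.
  rewrite ler_norml; apply/andP; split.
    by apply: le_trans (ltW (lo l m)); rewrite lerN2 le_max lexx.
  rewrite le_max; have [->|ji] := eqVneq l i.
    by rewrite (ltW (hi1 m)) orbT.
  by rewrite ltW // hi.
pose K3 a := \sum_l `|c a l| * K2.
have aK3 a m : `|dot a (pt m)| <= K3 a.
  rewrite expand; apply: le_trans (ler_norm_sum _ _ _) _.
  by apply: ler_sum => l _; rewrite normrM ler_wpM2l.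
have K2_ge0 : 0 <= K2 by rewrite le_max ler01.
pose K4 := \sum_(a <- Phi) K3 a.
have K34 a : a \in Phi -> K3 a <= K4.
  move=> Pa; rewrite /K4 (big_rem a) //= lerDl sumr_ge0 // => b _.
  by apply: sumr_ge0 => l _; rewrite mulr_ge0.
pose A h := exists k, h = ibeta w k.
have [|T AT] := @aroot_level_bound K4 A.
  move=> _ [k ->]; split; first exact: aroot_ibeta.
  have Pk := (aroot_ibeta w k).1.
  have pos q : (q < size (mkseq w k.+1))%N -> positive (beta (mkseq w k.+1) q).
    rewrite size_mkseq => qk; rewrite beta_mkseq //.
    by move/infinite_reducedP: w_reduced; apply.
  (* The level of a crossed wall lies between the values of its direction at the two ends of the
     step. *)
  have := beta_uncrossed (mkseq w k.+1) k.
  have := beta_crossed pos (k := k) (p := k.+1).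
  rewrite beta_mkseq // !take_mkseq // size_mkseq ltnSn => /(_ isT).
  rewrite -!/(pt _) /aff_eval -leNgt subr_le0 subr_gt0 => k1 k0.
  apply: le_trans (K34 _ Pk); rewrite ler_norml; apply/andP; split.
    apply: le_trans k1; have := aK3 (ibeta w k).1 k.+1.
    by rewrite ler_norml => /andP[].
  apply: le_trans (ltW k0) _.
  by have := aK3 (ibeta w k).1 k; rewrite ler_norml => /andP[].
(* Pigeonhole: [size T] affine roots cannot contain one more distinct wall. *)
have uT : uniq [seq ibeta w k | k <- iota 0 (size T).+1].
  by rewrite map_inj_uniq ?iota_uniq //; apply: ibeta_inj.
have := uniq_leq_size uT (s2 := T); rewrite size_map size_iota ltnn => H.
suff: false by [].
by apply: H => h /mapP[k _ ->]; apply: AT; exists k.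
Qed.

End RayMinimality.

(** * Coxeter vectors *)

Definition coxeter_word u := perm_eq u (enum 'I_n.+1).

Lemma coxeter_word_uniq u : coxeter_word u -> uniq u.
Proof. by move=> /perm_uniq ->; rewrite enum_uniq. Qed.

Lemma coxeter_word_mem u j : coxeter_word u -> j \in u.
Proof. by move=> /perm_mem ->; rewrite mem_enum. Qed.

Lemma coxeter_word_size u : coxeter_word u -> size u = n.+1.
Proof. by move=> /perm_size ->; rewrite size_enum_ord. Qed.

Lemma coxeter_word_sum (M : nmodType) u (G : 'I_n.+1 -> M) :
  coxeter_word u -> \sum_(j <- u) G j = \sum_j G j.
Proof. by move=> pu; rewrite (perm_big _ pu) big_enum. Qed.

Lemma sum_before (M : nmodType) u k (G : 'I_n.+1 -> M) : coxeter_word u ->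
  \sum_(j | (index j u < k)%N) G j = \sum_(j <- take k u) G j.
Proof.
move=> pu; have uu := coxeter_word_uniq pu.
have /(subseq_uniqP uu) -> := take_subseq u k.
rewrite big_filter big_mkcond -(coxeter_word_sum _ pu) [RHS]big_mkcond.
by apply: eq_bigr => j _; rewrite in_take // coxeter_word_mem.
Qed.

(* The values on the simple affine roots that a vector must have for each letter
   [j] of [u], applied in turn, to displace it by [mark j] times its root. *)
Definition drift u j : R := - (mark j * dot (aff j).1 (aff j).1 / 2) -
  \sum_(p | (index p u < index j u)%N) mark p * dot (aff j).1 (aff p).1.

(** Only the values at the simple roots are prescribed; [drift_sum] forces the right value at the
    affine node. *)
Definition coxeter_vector u : V := \sum_i drift u (lift ord0 i) *: omega i.

(** The squared norm of the zero vector in [mark_sum] splits into the diagonal and two equal halves,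
    one for each order of a pair in [u]. *)
Lemma drift_sum u : coxeter_word u -> \sum_j mark j * drift u j = 0.
Proof.
move=> pu; pose G j p := mark j * (mark p * dot (aff j).1 (aff p).1).
have tot : \sum_j \sum_p G j p = 0.
  transitivity (dot (\sum_j mark j *: (aff j).1) (\sum_j mark j *: (aff j).1));
    last by rewrite mark_sum dot0l.
  rewrite dot_suml.
  apply: eq_bigr => j _; rewrite dotZl dot_sumr mulr_sumr.
  by apply: eq_bigr => p _; rewrite dotZr.
pose B := \sum_j \sum_(p | (index p u < index j u)%N) G j p.
have split_tot : \sum_j \sum_p G j p = \sum_j G j j + (B + B).
  have -> : B + B = B + \sum_j \sum_(p | (index j u < index p u)%N) G j p.
    congr (_ + _); rewrite /B (exchange_big_dep xpredT) //=.
    apply: eq_bigr => j _.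
    by apply: eq_bigr => p _; rewrite /G dotC mulrCA.
  rewrite -!big_split /=; apply: eq_bigr => j _; rewrite (bigD1 j) //=.
  congr (_ + _); rewrite (bigID (fun p => (index p u < index j u)%N)) /=.
  have iu p : (index p u == index j u) = (p == j).
    apply/eqP/eqP => [E|->//].
    rewrite -(nth_index ord0 (coxeter_word_mem p pu)) E.
    by rewrite nth_index ?coxeter_word_mem.
  congr (_ + _); apply: eq_bigl => p; rewrite -iu; case: ltngtP => //.
have -> : \sum_j mark j * drift u j = - (\sum_j G j j / 2 + B).
  rewrite /B -big_split /= -sumrN; apply: eq_bigr => j _.
  by rewrite /drift /G -mulr_sumr; field.
rewrite -mulr_suml; move: split_tot; rewrite tot; lra.
Qed.

Lemma dot_coxeter_vector u j : coxeter_word u ->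
  dot (aff j).1 (coxeter_vector u) = drift u j.
Proof.
move=> pu.
have simple i : dot (alpha i) (coxeter_vector u) = drift u (lift ord0 i).
  rewrite dot_sumr (bigD1 i) //= dotZr omega_coweights eqxx mulr1 big1 ?addr0 //.
  by move=> p li; rewrite dotZr omega_coweights eq_sym (negPf li) mulr0.
have [i ->|->] := unliftP ord0 j; first by rewrite affS simple.
have := drift_sum pu; rewrite big_ord_recl mark0 mul1r aff0 /=.
move/eqP; rewrite addr_eq0 => /eqP ->; rewrite dotNl; congr (- _).
rewrite {1}(coweight_expand xi) dot_suml; apply: eq_bigr => i _.
by rewrite dotZl simple markS.
Qed.

(** The first letter has no predecessors, so its drift is strictly negative. *)
Lemma coxeter_vector_neq0 u : coxeter_word u -> coxeter_vector u != 0.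
Proof.
move=> pu; have u0 : (0 < size u)%N by rewrite coxeter_word_size.
pose j := nth ord0 u 0; have ij : index j u = 0%N.
  by rewrite /j; case: (u) u0 => //= b s; rewrite eqxx.
have := dot_coxeter_vector j pu; apply: contra_eq_neq => ->; rewrite dot0r.
rewrite /drift ij big_pred0 // subr0 eq_sym oppr_eq0 gt_eqF //.
by rewrite divr_gt0 ?mulr_gt0 ?mark_gt0 ?dot_gt0 ?aff_neq0 ?ltr0n.
Qed.

Lemma lin_rev_take u k y : (k < size u)%N ->
  lin (rev (take k.+1 u)) y =
  refl dot (aff (nth ord0 u k)).1 0 (lin (rev (take k u)) y).
Proof. by move=> ku; rewrite (take_nth ord0) // rev_rcons. Qed.

(* Each letter moves the running image of the Coxeter vector by its own term of
   the relation [mark_sum], so the total displacement is 0. *)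
Lemma coxeter_vector_path u k : coxeter_word u -> (k <= size u)%N ->
  lin (rev (take k u)) (coxeter_vector u) =
  coxeter_vector u + \sum_(j <- take k u) mark j *: (aff j).1.
Proof.
move=> pu; elim: k => [|k IH] ku; first by rewrite take0 big_nil addr0.
rewrite lin_rev_take // IH ?(ltnW ku) //.
set j := nth ord0 u k; set y := _ + _.
have ij : index j u = k by rewrite index_uniq // coxeter_word_uniq.
have yj : dot (aff j).1 y = - (mark j * dot (aff j).1 (aff j).1 / 2).
  rewrite dotDr dot_coxeter_vector // /drift ij sum_before // dot_sumr.
  by under [X in _ + X]eq_bigr do rewrite dotZr; rewrite subrK.
rewrite refl0E /cartan dotC yj (take_nth ord0) // -cats1 big_cat big_seq1 /=.
rewrite -/j [RHS]addrA -/y -scaleNr; congr (_ + _ *: _).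
have : dot (aff j).1 (aff j).1 != 0 by rewrite dot_eq0 aff_neq0.
by move=> ?; field.
Qed.

Lemma coxeter_vector_fixed u : coxeter_word u ->
  lin u (coxeter_vector u) = coxeter_vector u.
Proof.
move=> pu; have := coxeter_vector_path pu (leqnn _).
rewrite take_size coxeter_word_sum // mark_sum addr0 => {1}<-.
by rewrite lin_Krev.
Qed.

(** Pulled back along the prefix, the pairing is that of the letter with the running image, where
    only the negative diagonal term of [drift] remains. *)
Lemma coxeter_vector_beta u k : coxeter_word u -> (k < size u)%N ->
  dot (beta u k).1 (coxeter_vector u) < 0.
Proof.
move=> pu ku; rewrite /beta act_fst lin_adj coxeter_vector_path ?(ltnW ku) //.
set j := nth ord0 u k.
have ij : index j u = k by rewrite index_uniq // coxeter_word_uniq.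
rewrite dotDr dot_coxeter_vector // /drift ij sum_before // dot_sumr.
under [X in _ + X]eq_bigr do rewrite dotZr; rewrite subrK oppr_lt0.
by rewrite divr_gt0 ?mulr_gt0 ?mark_gt0 ?dot_gt0 ?aff_neq0 ?ltr0n.
Qed.

(** Pairing with the coweights shows that [mark_sum] spans all relations between the affine simple
    roots. *)
Lemma aff_relation (c : 'I_n.+1 -> R) :
  \sum_j c j *: (aff j).1 = 0 -> forall j, c j = c ord0 * mark j.
Proof.
move=> c0 j; have [i ->|->] := unliftP ord0 j; last by rewrite mark0 mulr1.
have := dot0l dot (omega i); rewrite -c0 big_ord_recl aff0 /=.
rewrite dotDl dotZl dotNl dot_suml (bigD1 i) //= affS dotZl omega_coweights eqxx.
rewrite big1 => [|p li]; last first.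
  by rewrite affS dotZl omega_coweights (negPf li) mulr0.
by rewrite markS mulr1; lra.
Qed.

(** The displacements of a fixed [y] along the word sum to 0, so they are proportional to the marks.
    The values of [y] then obey the equations that define [drift]. *)
Lemma coxeter_fixed_line u y : coxeter_word u -> lin u y = y ->
  exists t : R, y = t *: coxeter_vector u.
Proof.
move=> pu uy; pose yk k := lin (rev (take k u)) y.
pose c j := cartan dot (yk (index j u)) (aff j).1.
have path k : (k <= size u)%N ->
    yk k = y - \sum_(j <- take k u) c j *: (aff j).1.
  elim: k => [|k IH] ku; first by rewrite /yk take0 big_nil subr0.
  rewrite /yk lin_rev_take // -/(yk k) refl0E {1}IH ?(ltnW ku) //.
  rewrite (take_nth ord0) // -cats1 big_cat big_seq1 /= opprD addrA.
  by rewrite /c index_uniq // coxeter_word_uniq.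
have /aff_relation cE : \sum_j c j *: (aff j).1 = 0.
  have := path _ (leqnn _).
  rewrite coxeter_word_sum ?take_size // /yk take_size.
  rewrite -{1}uy lin_revK => /eqP.
  by rewrite -subr_eq0 opprB addrC subrK => /eqP.
(* The sign appears because the path of [y] subtracts its terms while that of the Coxeter vector
   adds them. *)
exists (- c ord0); apply: simple_eq => i; rewrite dotZr.
have := dot_coxeter_vector (lift ord0 i) pu; rewrite affS /= => ->.
set j := lift ord0 i.
have ji : (index j u < size u)%N by rewrite index_mem coxeter_word_mem.
have := cE j; rewrite {1}/c path ?(ltnW ji) // /cartan.
have nz : dot (aff j).1 (aff j).1 != 0 by rewrite dot_eq0 aff_neq0.
rewrite dotDl dotNl dot_suml -sum_before // => cj.
have -> : alpha i = (aff j).1 by rewrite affS.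
rewrite /drift -/j.
rewrite [dot (aff j).1 y]dotC.
have -> : dot y (aff j).1 = c ord0 * mark j * dot (aff j).1 (aff j).1 / 2 +
  \sum_(p | (index p u < index j u)%N) dot (c p *: (aff p).1) (aff j).1.
  by rewrite -cj; field.
rewrite (_ : \sum_(p | _) dot _ _ = c ord0 *
  \sum_(p | (index p u < index j u)%N) mark p * dot (aff j).1 (aff p).1).
  by field.
rewrite mulr_sumr; apply: eq_bigr => p _.
by rewrite dotZl cE dotC mulrA.
Qed.

(** * Coxeter nodes *)

Lemma omega_neq0 i : omega i != 0.
Proof.
apply/eqP => wi; have := omega_coweights i i; rewrite wi dot0r eqxx.
by move/eqP; rewrite eq_sym oner_eq0.
Qed.

(* A Coxeter word [u] sits over node [i] when its Coxeter vector lies on the ray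
   of a Weyl translate of [omega i]. *)
Definition over_node u i :=
  exists d (t : R), 0 < t /\ coxeter_vector u = t *: lin d (omega i).

Lemma dominant_omega i : dominant (omega i).
Proof. by move=> l; rewrite omega_coweights ler0n. Qed.

Lemma over_node_exists u : coxeter_word u -> exists i, over_node u i.
Proof.
move=> pu; pose v := coxeter_vector u.
have [d _ dom] := dominate v.
(* [g] is the linear part of [u] conjugated to fix the dominant image of [v], rewritten in simple
   reflections for [dominant_stab]. *)
have [g fg gE] := lin_finite (d ++ u ++ rev d).
have gv : lin g (lin d v) = lin d v.
  by rewrite gE !lin_cat lin_revK coxeter_vector_fixed.
have [i vi] : exists i, dot (alpha i) (lin d v) != 0.
  apply: contrapT => /forallNP nv; case/eqP: (coxeter_vector_neq0 pu).
  rewrite -/v -(lin_revK dot alpha xi d v) (_ : lin d v = 0).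
    by rewrite -(scale0r v) linZ !scale0r.
  by apply: simple_eq => i; rewrite dot0r; apply/eqP/negPn/negP/nv.
(* Simple roots vanishing on the dominant image differ from [alpha i], so they vanish on [omega i]
   too. *)
have gi : lin g (omega i) = omega i.
  apply: (@dominant_stab _ (lin d v)); rewrite ?gv // => l vl.
  by rewrite omega_coweights; case: eqP => // li; rewrite -li vl eqxx in vi.
have [t tE] : exists t : R, lin (rev d) (omega i) = t *: v.
  apply: (coxeter_fixed_line pu).
  rewrite -[RHS]/(lin (rev d) (omega i)) -{2}gi gE.
  by rewrite !lin_cat lin_revK.
have {}tE : omega i = t *: lin d v by rewrite -linZ -tE lin_Krev.
have ti : t * dot (alpha i) (lin d v) = 1.
  by rewrite -dotZr -tE omega_coweights eqxx.
have vi0 : 0 < dot (alpha i) (lin d v) by rewrite lt_def vi dom.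
have t0 : 0 < t by rewrite -(pmulr_lgt0 _ vi0) ti.
exists i, (rev d), t^-1; split; first by rewrite invr_gt0.
by rewrite tE linZ scalerA mulVf ?scale1r ?lin_revK // gt_eqF.
Qed.

(** [dominant_stab], applied to a vector as its own [v], shows that dominant vectors in one orbit
    are equal. *)
Lemma ray_dominant_eq u i l (s t : R) : 0 < s -> 0 < t ->
  lin u (s *: omega i) = t *: omega l -> i = l.
Proof.
move=> s0 t0 E; have [w fw wE] := lin_finite u.
have dom p (c : R) : 0 < c -> dominant (c *: omega p).
  by move=> c0 q; rewrite dotZr mulr_ge0 ?dominant_omega // ltW.
have := @dominant_stab w (s *: omega i) (s *: omega i) fw (dom _ _ s0).
rewrite wE E => /(_ (dom _ _ t0) (fun _ => id)) /(congr1 (dot (alpha i))).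
rewrite !dotZr !omega_coweights eqxx mulr1.
by have [//|_] := eqVneq i l; rewrite mulr0 => /eqP; rewrite eq_sym gt_eqF.
Qed.

Lemma over_node_unique u u' d i l : over_node u i -> over_node u' l ->
  coxeter_vector u' = lin d (coxeter_vector u) -> i = l.
Proof.
move=> [a [s [s0 ->]]] [b [t [t0 ->]]] E.
apply: (@ray_dominant_eq (rev b ++ d ++ a) i l s t s0 t0).
by rewrite !lin_cat linZ -E linZ lin_revK.
Qed.

Lemma directed_scale (t : R) v w : 0 < t ->
  directed (t *: v) w <-> directed v w.
Proof.
move=> t0; split=> dw k; have := dw k; first by rewrite dotZr pmulr_rlt0.
by rewrite dotZr pmulr_rlt0.
Qed.

Lemma directed_Inv_eq d i w w' : directed (lin d (omega i)) w ->
  directed (lin d (omega i)) w' -> Inv w = Inv w'.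
Proof.
move=> dw dw'; have rw := directed_reduced dw; have rw' := directed_reduced dw'.
apply: Inv_eq => // f Pf f0; split=> -[k fk]; apply: ray_minimal => //.
- by rewrite fk.
- by rewrite fk.
Qed.

(** A word whose inversions lie below those of [w] is directed by the same ray, hence has the same
    inversion set. *)
Lemma directed_minimal d i w : directed (lin d (omega i)) w ->
  minimal_limit_element dot alpha xi (limit_class dot alpha xi w).
Proof.
move=> dw; have rw := directed_reduced dw; split; first by exists w.
move=> _ [w' rw' ->] [p [q [[rp Ep] [rq Eq] pq]]].
rewrite {}Ep {}Eq in pq; apply: limit_class_eq.
apply: (directed_Inv_eq _ dw) => k.
have pk : positive (ibeta w' k) by move/infinite_reducedP: rw'; apply.
have [|p0 ->] := (Inv_refl rw (aroot_ibeta w' k) pk).1; last exact: dw.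
by apply: pq; apply/InvP; exists k.
Qed.

Lemma coxeter_word_directed u : coxeter_word u ->
  directed (coxeter_vector u) (infinite_repeat u).
Proof.
move=> pu; apply: repeat_directed; first by rewrite coxeter_word_size.
  exact: coxeter_vector_fixed.
by move=> k; apply: coxeter_vector_beta.
Qed.

Lemma repeat_reduced u : infinite_reduced (infinite_repeat u) -> reduced u.
Proof.
have [/eqP|u0] := posnP (size u); first by rewrite size_eq0 => /eqP -> _ v.
by move=> /(_ (1 * size u)%N); rewrite mkseq_repeat_power // /power /= cats0.
Qed.

Lemma coxeter_limit_power u : coxeter_word u ->
  limit_power dot alpha xi (word_prod u) =
  limit_class dot alpha xi (infinite_repeat u).
Proof.
move=> pu; have ri := directed_reduced (coxeter_word_directed pu).
by apply: limit_powerE; rewrite ?coxeter_word_size //; apply: repeat_reduced.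
Qed.

Lemma coxeter_minimal u : coxeter_word u ->
  minimal_limit_element dot alpha xi (limit_power dot alpha xi (word_prod u)).
Proof.
move=> pu; rewrite coxeter_limit_power //.
have [i [d [t [t0 E]]]] := over_node_exists pu.
apply: (@directed_minimal d i); apply/(directed_scale _ _ t0).
by rewrite -E; apply: coxeter_word_directed.
Qed.

Lemma reduced_word u : exists2 w, reduced w & word_prod w = word_prod u.
Proof.
have [N] := ubnP (size u); elim: N u => // N IH u uN.
have [ru|] := pselect (reduced u); first by exists u.
move=> /existsNP[v] /not_implyP[vu] /negP; rewrite -ltnNge => sv.
have [|w rw wv] := IH v; first exact: leq_trans sv uN.
by exists w; rewrite // wv.
Qed.

(** * Translations in the affine Weyl group *)

Definition is_word (T : V -> V) := exists u, word_prod u = T.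

(** The reflections in the walls of [a] at levels 1 and 0 compose to the translation by its
    coroot. *)
Lemma translation_root a : a \in Phi -> is_word (translation (coroot dot a)).
Proof.
move=> Pa; have [|u uE] := @word_refl (a, 1); first by split; rewrite ?rpred1.
have [|v vE] := @word_refl (a, 0); first exact: aroot_level0.
exists (u ++ v); apply/funext => x.
have aa : dot a a != 0 by rewrite dot_eq0 root_neq0.
rewrite word_prod_cat uE vE /= !reflE /translation /coroot !dotE.
rewrite -addrA -opprD -scalerDl -scaleNr; congr (_ + _ *: _).
by field.
Qed.

Lemma translationD x y : is_word (translation x) -> is_word (translation y) ->
  is_word (translation (x + y)).
Proof.
move=> [u uE] [v vE]; exists (u ++ v); apply/funext => z.
by rewrite word_prod_cat uE vE /translation [x + y]addrC addrA.
Qed.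

Lemma translation0 : is_word (translation (0 : V)).
Proof. by exists [::]; apply/funext => z; rewrite /translation addr0. Qed.

Lemma translationN x : is_word (translation x) -> is_word (translation (- x)).
Proof.
move=> [u uE]; exists (rev u); apply/funext => z.
rewrite -[z in LHS](subrK x) -[z - x + x]/(translation x (z - x)) -uE.
by rewrite word_prod_revK //; exact: aff_neq0.
Qed.

Lemma translation_lattice x : coroot_lattice dot alpha x ->
  is_word (translation x).
Proof.
have nat_mul y k : is_word (translation y) -> is_word (translation (y *+ k)).
  move=> ty; elim: k => [|k IH]; first exact: translation0.
  by rewrite mulrS; apply: translationD.
move=> [m ->].
elim/big_ind: _ => [||i _]; [exact: translation0|exact: translationD|].
have ti := translation_root (alpha_root i).
case: (m i) => k; first exact: nat_mul.
by rewrite NegzE mulrNz; apply/translationN/nat_mul.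
Qed.

Lemma translation_lin u x : is_word (translation x) ->
  is_word (translation (lin u x)).
Proof.
move=> [v vE]; exists (u ++ v ++ rev u); apply/funext => z.
rewrite !word_prod_cat vE /translation word_prodD word_prod_Krev //.
exact: aff_neq0.
Qed.

Lemma translation_lin_fixed u x : word_prod u = translation x ->
  forall y, lin u y = y.
Proof.
move=> ux y; rewrite -[y]subr0 -(word_prodB dot alpha xi) ux /translation.
by rewrite opprD addrACA subrr addr0.
Qed.

(** A wall crossed within one period is positive at the base point and not at its translate by [x],
    so its direction is negative on [x]. *)
Lemma translation_directed u x : x != 0 -> reduced u ->
  word_prod u = translation x -> directed x (infinite_repeat u).
Proof.
move=> x0 ru ux; apply: repeat_directed.
- rewrite lt0n size_eq0; apply: contra_neq x0 => u0.
  by have := congr1 (fun h => h 0) ux; rewrite u0 /translation add0r => /esym.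
- exact: translation_lin_fixed ux x.
move=> l lu; have pl := reduced_beta ru lu.
have := beta_crossed (fun k => reduced_beta ru (k := k)) (k := l) (p := size u).
rewrite lu leqnn => /(_ isT); rewrite take_size ux /translation.
move: pl; rewrite /positive /aff_eval dotDr => h1 h2; rewrite -leNgt in h2; lra.
Qed.

Lemma translation_power u d i (c : R) : 0 < c -> reduced u ->
  word_prod u = translation (c *: lin d (omega i)) ->
  directed (lin d (omega i)) (infinite_repeat u) /\
  limit_power dot alpha xi (translation (c *: lin d (omega i))) =
  limit_class dot alpha xi (infinite_repeat u).
Proof.
move=> c0 ru uE; have nz : c *: lin d (omega i) != 0.
  rewrite scaler_eq0 negb_or gt_eqF //= -(dot_eq0 dot) lin_isom dot_eq0.
  exact: omega_neq0.
have dir := translation_directed nz ru uE.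
split; first by apply/(directed_scale _ _ c0).
rewrite -uE; apply: limit_powerE => //; last exact: directed_reduced dir.
rewrite lt0n size_eq0; apply: contra_neq nz => u0.
by have := congr1 (fun h => h 0) uE; rewrite u0 /translation add0r => /esym.
Qed.

(* The affine root [(a, -1)] is positive for every root [a], so it detects the
   sign of [a] on the ray. *)
Lemma Inv_directions w w' d d' i i' :
  directed (lin d (omega i)) w -> directed (lin d' (omega i')) w' ->
  Inv w = Inv w' -> forall a, a \in Phi ->
  dot a (lin d (omega i)) < 0 -> dot a (lin d' (omega i')) < 0.
Proof.
move=> dw dw' ww' a Pa ai.
have Pf : aroot (a, -1) by split; rewrite ?rpredN ?rpred1.
have f0 : positive (a, -1) by apply: coef0_positive; rewrite // coef0 /= opprK.
have rw := directed_reduced dw; have rw' := directed_reduced dw'.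
have := ray_minimal rw dw Pf f0 ai.
move=> /(Inv_refl rw Pf f0); rewrite ww' => /(Inv_refl rw' Pf f0)[k E].
by have := dw' k; rewrite -E.
Qed.

(** A converse to [directed_Inv_eq]: equal inversion sets give every root the same sign on both
    vectors. After pulling back by [d], the simple roots other than [alpha i] and their opposites
    are not negative, so they vanish. *)
Lemma Inv_ray w w' d d' i i' :
  directed (lin d (omega i)) w -> directed (lin d' (omega i')) w' ->
  Inv w = Inv w' ->
  exists2 s : R, 0 < s & lin d' (omega i') = s *: lin d (omega i).
Proof.
move=> dw dw' ww'; pose v := lin (rev d) (lin d' (omega i')).
have neg a : a \in Phi -> (dot a v < 0) = (dot a (omega i) < 0).
  move=> Pa; rewrite /v -lin_adj -(lin_isom dot alpha xi d a (omega i)).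
  have Pda : lin d a \in Phi by rewrite lin_root.
  by apply/idP/idP; apply: Inv_directions => //; rewrite ww'.
have pos l : (0 < dot (alpha l) v) = (l == i).
  rewrite -oppr_lt0 -dotNl neg ?rootN ?alpha_root // dotNl oppr_lt0.
  by rewrite omega_coweights ltr0n lt0b.
exists (dot (alpha i) v); first by rewrite pos.
rewrite -linZ -[LHS](lin_Krev dot alpha xi d) -/v; congr (lin d _).
apply: simple_eq => l; rewrite dotZr omega_coweights.
have [->|li] := eqVneq l i; first by rewrite mulr1.
rewrite mulr0; apply/le_anti; rewrite !leNgt pos li neg ?alpha_root //.
by rewrite omega_coweights (negPf li) ltxx.
Qed.

Section CoxeterNodes.
Variable k : 'I_n -> nat.
Hypothesis k_least : least_coweight_multiples dot alpha omega k.

Local Notation coxeter_node := (coxeter_node dot alpha xi Phi omega k).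

Lemma node_word d i : exists2 u, reduced u &
  word_prod u = translation ((k i)%:R *: lin d (omega i)).
Proof.
have [_ /translation_lattice + _] := k_least i.
move=> /(translation_lin d); rewrite -scaler_nat linZ => -[u uE].
by have [w rw wE] := reduced_word u; exists w; rewrite // wE.
Qed.

(** Equality of limit elements becomes equality of rays, by [Inv_ray] in one direction and
    [directed_Inv_eq] in the other. *)
Lemma coxeter_nodeP i : coxeter_node i <->
  exists2 u, coxeter_word u & over_node u i.
Proof.
have k0 p : 0 < (k p)%:R :> R by have [kp _ _] := k_least p; rewrite ltr0n.
split.
  move=> [w [c [/weyl_lin[d dw] [u pu ->]]]].
  rewrite -dw -scaler_nat linZ coxeter_limit_power //.
  have [v rv vE] := node_word d i.
  have [dv ->] := translation_power (k0 i) rv vE.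
  have [i' [d' [t [t0 E]]]] := over_node_exists pu.
  have du : directed (lin d' (omega i')) (infinite_repeat u).
    by apply/(directed_scale _ _ t0); rewrite -E; apply: coxeter_word_directed.
  move=> Evu; exists u => //.
  have : limit_class dot alpha xi (infinite_repeat v) (infinite_repeat v).
    by split; first exact: directed_reduced dv.
  rewrite Evu => -[_ /(Inv_ray dv du)[s s0 sE]].
  exists d, (t * s); split; first exact: mulr_gt0.
  by rewrite E sE scalerA.
move=> [u pu [d [t [t0 E]]]]; exists (lin d), (word_prod u).
split; [exact: lin_weyl|by exists u|].
rewrite -scaler_nat linZ coxeter_limit_power //.
have [v rv vE] := node_word d i.
have [dv ->] := translation_power (k0 i) rv vE.
apply/limit_class_eq/(directed_Inv_eq dv)/(directed_scale _ _ t0).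
by rewrite -E; apply: coxeter_word_directed.
Qed.

Lemma coxeter_node_exists : exists i, coxeter_node i.
Proof.
have pu : coxeter_word (enum 'I_n.+1) by exact: perm_refl.
have [i ui] := over_node_exists pu.
by exists i; apply/coxeter_nodeP; exists (enum 'I_n.+1).
Qed.

End CoxeterNodes.

(** * Coxeter vectors and orientations of the affine diagram *)

Definition edge j p := (j != p) && (dot (aff j).1 (aff p).1 != 0).

Definition before u j p := (index j u < index p u)%N.

Lemma edge_sym j p : edge j p = edge p j.
Proof. by rewrite /edge eq_sym dotC. Qed.

(** Predecessors not joined to [j] contribute 0 to [drift u j]. *)
Lemma coxeter_vector_orientation u u' :
  (forall j p, edge j p -> before u j p = before u' j p) ->
  coxeter_vector u = coxeter_vector u'.
Proof.
move=> uu'; apply: eq_bigr => i _; congr (_ *: _); congr (_ - _).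
rewrite big_mkcond [RHS]big_mkcond; apply: eq_bigr => p _ /=.
set j := lift ord0 i; have [<-|pj] := eqVneq p j; first by rewrite !ltnn.
have [->|nz] := eqVneq (dot (aff j).1 (aff p).1) 0.
  by rewrite mulr0 !if_same.
by have := uu' p j; rewrite /before /edge pj dotC nz => ->.
Qed.

Lemma before_filter (T : pred 'I_n.+1) u j p : T j -> T p ->
  before [seq q <- u | T q] j p = before u j p.
Proof.
move=> Tj Tp; rewrite /before; elim: u => //= q u IH.
have [Tq|Tq] := boolP (T q) => /=.
  by case: (q == p); case: (q == j); rewrite //= ltnS.
have [qp|_] := eqVneq q p; first by rewrite qp Tp in Tq.
have [qj|_] := eqVneq q j; first by rewrite qj Tj in Tq.
by rewrite ltnS.
Qed.

Lemma before_neg u j p : coxeter_word u -> j != p ->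
  before u p j = ~~ before u j p.
Proof.
move=> pu jp; rewrite /before -leqNgt [RHS]leq_eqVlt; case: eqP => // E.
case/eqP: jp; rewrite -(nth_index ord0 (coxeter_word_mem j pu)) -E.
by rewrite nth_index // coxeter_word_mem.
Qed.

Lemma coxeter_word_catC u1 u2 :
  coxeter_word (u1 ++ u2) = coxeter_word (u2 ++ u1).
Proof. by rewrite /coxeter_word perm_catC. Qed.

(** Away from [j], the letter [j] drops out of the predecessors. At [j], all other letters become
    predecessors, and the relation [mark_sum] evaluates the change. *)
Lemma coxeter_vector_rot1 j u : coxeter_word (j :: u) ->
  coxeter_vector (rcons u j) = lin [:: j] (coxeter_vector (j :: u)).
Proof.
move=> pju; have -> : lin [:: j] (coxeter_vector (j :: u)) =
    coxeter_vector (j :: u) + mark j *: (aff j).1.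
  by have := coxeter_vector_path (k := 1) pju isT; rewrite /= take0 big_seq1.
have pu : coxeter_word (rcons u j).
  by rewrite -cats1 coxeter_word_catC.
apply: simple_eq => i.
have Ea : alpha i = (aff (lift ord0 i)).1 by rewrite affS.
rewrite Ea dotDr !dot_coxeter_vector // dotZr; set a := lift ord0 i.
have /andP[ju uu] : uniq (j :: u) by apply: coxeter_word_uniq.
rewrite /drift !sum_before //; have [aj|aj] := eqVneq a j.
  rewrite aj /= eqxx take0 big_nil -cats1 index_cat (negPf ju) /= eqxx addn0.
  rewrite take_size_cat //.
  have : \sum_(p <- j :: u) mark p * dot (aff j).1 (aff p).1 = 0.
    transitivity (dot (aff j).1 (\sum_p mark p *: (aff p).1)).
      rewrite coxeter_word_sum // dot_sumr.
      by apply: eq_bigr => p _; rewrite dotZr.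
    by rewrite mark_sum dot0r.
  by rewrite big_cons; lra.
have au : a \in u by have := coxeter_word_mem a pju; rewrite inE (negPf aj).
rewrite /= eq_sym (negPf aj) /= big_cons -cats1 index_cat au.
by rewrite takel_cat ?index_size //; lra.
Qed.

Lemma coxeter_vector_rot u1 u2 : coxeter_word (u1 ++ u2) ->
  coxeter_vector (u2 ++ u1) = lin (rev u1) (coxeter_vector (u1 ++ u2)).
Proof.
elim: u1 u2 => [|j u1 IH] u2 pu; first by rewrite cats0.
rewrite -cat_rcons IH; last first.
  by rewrite -cats1 catA coxeter_word_catC.
by rewrite -rcons_cat coxeter_vector_rot1 // rev_cons -cats1 lin_cat.
Qed.

(* Moving the letters of [T] past the others reverses exactly the edges between
   [T] and its complement. *)
Lemma coxeter_flip (T : pred 'I_n.+1) u : coxeter_word u ->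
  (forall j p, T j -> ~~ T p -> edge j p -> before u j p) ->
  exists d u', [/\ coxeter_word u',
    coxeter_vector u' = lin d (coxeter_vector u) &
    forall j p, edge j p ->
      before u' j p = if T j == T p then before u j p else before u p j].
Proof.
move=> pu cross; pose u1 := [seq q <- u | T q].
pose u2 := [seq q <- u | predC T q].
have p12 : coxeter_word (u1 ++ u2).
  by rewrite /coxeter_word /u1 /u2 (perm_trans _ pu) // perm_filterC.
have m1 j : (j \in u1) = T j.
  by rewrite mem_filter (coxeter_word_mem j pu) andbT.
have m2 j : (j \in u2) = ~~ T j.
  by rewrite mem_filter (coxeter_word_mem j pu) andbT.
have i1 j p : T j -> T p -> before u1 j p = before u j p.
  by apply: before_filter.
have i2 j p : ~~ T j -> ~~ T p -> before u2 j p = before u j p.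
  by move=> nj np; apply: before_filter.
exists (rev u1), (u2 ++ u1); split; first by rewrite coxeter_word_catC.
  rewrite coxeter_vector_rot //; congr (lin _ _).
  apply: coxeter_vector_orientation => j p jp.
  rewrite {1}/before !index_cat !m1.
  have [Tj|nTj] := boolP (T j); have [Tp|nTp] := boolP (T p).
  - exact: i1.
  - by rewrite (cross j p) // ltn_addr // index_mem m1.
  - have -> : before u j p = false.
      have jp' : j != p by case/andP: jp.
      by apply/negbTE; rewrite -(before_neg pu jp') (cross p j) // edge_sym.
    by apply/negbTE; rewrite -leqNgt; apply: leq_trans (leq_addr _ _);
      rewrite index_size.
  - by rewrite ltn_add2l -/(before u2 j p) i2.
move=> j p jp; rewrite {1}/before !index_cat !m2.
have jp' : j != p by case/andP: jp.
have [Tj|nTj] := boolP (T j); have [Tp|nTp] := boolP (T p) => //=.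
- by rewrite ltn_add2l -/(before u1 j p) i1.
- rewrite (before_neg pu jp') (cross j p) //.
  by apply/negbTE; rewrite -leqNgt; apply: leq_trans (leq_addr _ _);
    rewrite index_size.
- by rewrite (cross p j) 1?edge_sym // ltn_addr // index_mem m2.
- exact: i2.
Qed.

Definition edge_except j p : rel 'I_n.+1 := [rel a b | edge a b &&
  ~~ [|| (a == j) && (b == p) | (a == p) && (b == j)]].

(** Induction on the set [D] of edges on which the two orientations disagree. *)
Lemma forest_conjugate u u' : coxeter_word u -> coxeter_word u' ->
  (forall j p, edge j p -> ~~ connect (edge_except j p) j p) ->
  exists d, coxeter_vector u' = lin d (coxeter_vector u).
Proof.
move=> pu pu' forest.
pose D w := [set jp : 'I_n.+1 * 'I_n.+1 | edge jp.1 jp.2 &&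
  (before w jp.1 jp.2 != before u' jp.1 jp.2)]%SET.
have [N] := ubnP #|D u|; elim: N u pu => // N IH u pu uN.
have [D0|[[a b] abD]] := set_0Vmem (D u).
  exists [::]; apply: coxeter_vector_orientation => j p jp.
  have [//|ne] := eqVneq (before u j p) (before u' j p).
  have : (j, p) \in D u by rewrite inE /= jp ne.
  by rewrite D0 inE.
have [j [p [jp jpb jpb']]] : exists j p,
    [/\ edge j p, before u j p & ~~ before u' j p].
  move: abD; rewrite inE /= => /andP[ab]; have ab' : a != b by case/andP: ab.
  have [h|h] := boolP (before u a b);
    have [h'|h'] := boolP (before u' a b) => // _.
    by exists a, b.
  exists b, a; split; first by rewrite edge_sym.
    by rewrite (before_neg _ ab').
  by rewrite (before_neg _ ab') // h'.
(* [T] is the component of [j] once the edge from [j] to [p] is removed. No other edge leaves [T],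
   so [coxeter_flip] reverses this edge alone. *)
clear a b abD; pose T := connect (edge_except j p) j.
have Tj : T j by exact: connect0.
have nTp : ~~ T p by exact: forest.
have cross q r : T q -> ~~ T r -> edge q r -> q = j /\ r = p.
  move=> Ta nTb ab; have [|] := boolP (edge_except j p q r).
    by move=> /connect1 /(connect_trans Ta); rewrite -/(T r) (negPf nTb).
  rewrite /edge_except /= ab /= negbK => /orP[/andP[/eqP-> /eqP->]//|].
  by move=> /andP[/eqP ap _]; rewrite ap (negPf nTp) in Ta.
have [|d [w [pw wE wb]]] := @coxeter_flip T u pu.
  by move=> q r Ta nTb /(cross q r Ta nTb)[-> ->].
have [|d' d'E] := IH w pw.
  rewrite ltnS in uN; apply: leq_trans uN.
  apply: proper_card; apply/properP; split.
    apply/fintype.subsetP => -[q r]; rewrite !inE /= => /andP[ab].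
    rewrite ab /= wb //.
    case: ifP => //; have [Ta|Ta] := boolP (T q);
      have [Tb|Tb] := boolP (T r) => // _.
      by have [-> ->] := cross q r Ta Tb ab; rewrite jpb (negPf jpb').
    have [-> ->] : r = j /\ q = p by apply: cross; rewrite // edge_sym.
    have jp' : j != p by case/andP: jp.
    by rewrite !(before_neg _ jp') // jpb (negPf jpb').
  exists (j, p); first by rewrite inE /= jp jpb (negPf jpb').
  rewrite inE /= jp wb // Tj (negPf nTp) /=.
  have jp' : j != p by case/andP: jp.
  by rewrite (before_neg _ jp') // jpb (negPf jpb').
by exists (d' ++ d); rewrite lin_cat -wE.
Qed.

(** * Cycles in the affine diagram *)

(** The reflected root has coordinate 1 at [j], so all its coordinates are nonnegative; the one at
    [p] is minus the Cartan number. *)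
Lemma aff_dot_le0 j p : j != p -> dot (aff j).1 (aff p).1 <= 0.
Proof.
move=> jp; pose f := arefl dot (aff p) (aff j).
have Pf : aroot f by apply: aroot_arefl; exact: aroot_aff.
have cj : coef f j = 1.
  by rewrite coef_arefl !coef_aff eqxx eq_sym (negPf jp) mulr0 subr0.
have f0 : forall q, 0 <= coef f q.
  by case: (coef_sign Pf) => // /(_ j); rewrite cj ler10.
have := f0 p; rewrite coef_arefl !coef_aff eqxx (negPf jp) mulr1 sub0r oppr_ge0.
by rewrite /cartan pmulr_lle0 // divr_gt0 ?ltr0n ?dot_gt0 ?aff_neq0.
Qed.

Definition aff_norm j : R := Num.sqrt (dot (aff j).1 (aff j).1).

Definition unit_aff j : V := (aff_norm j)^-1 *: (aff j).1.

Lemma aff_norm_gt0 j : 0 < aff_norm j.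
Proof. by rewrite sqrtr_gt0 dot_gt0 // aff_neq0. Qed.

Lemma aff_norm_sqr j : aff_norm j ^+ 2 = dot (aff j).1 (aff j).1.
Proof. by rewrite sqr_sqrtr // dot_ge0. Qed.

Lemma unit_affE j p :
  dot (unit_aff j) (unit_aff p) =
  dot (aff j).1 (aff p).1 / (aff_norm j * aff_norm p).
Proof.
by rewrite dotZl dotZr invfM mulrA mulrC.
Qed.

Lemma unit_aff_self j : dot (unit_aff j) (unit_aff j) = 1.
Proof.
rewrite unit_affE -expr2 aff_norm_sqr divff // dot_eq0; exact: aff_neq0.
Qed.

Lemma unit_aff_le0 j p : j != p -> dot (unit_aff j) (unit_aff p) <= 0.
Proof.
move=> /aff_dot_le0 jp.
by rewrite unit_affE pmulr_lle0 // invr_gt0 mulr_gt0 ?aff_norm_gt0.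
Qed.

Lemma cartan_edge j p : edge j p -> cartan dot (aff j).1 (aff p).1 <= -1.
Proof.
move=> /andP[jp nz].
have : cartan dot (aff j).1 (aff p).1 < 0.
  rewrite /cartan pmulr_llt0; first by rewrite lt_neqAle nz aff_dot_le0.
  by rewrite divr_gt0 ?ltr0n ?dot_gt0 ?aff_neq0.
have /intrP[z ->] := cartan_int (aroot_aff p).1 (aroot_aff j).1.
rewrite ltrz0 => z0; have : z <= -1 by lia.
by rewrite -(ler_int R) rmorphN1.
Qed.

Lemma cartan_unit j p :
  cartan dot (aff j).1 (aff p).1 * cartan dot (aff p).1 (aff j).1 =
  4 * dot (unit_aff j) (unit_aff p) ^+ 2.
Proof.
rewrite unit_affE expr_div_n exprMn !aff_norm_sqr.
rewrite /cartan (dotC dot (aff p).1 (aff j).1).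
have nz q : dot (aff q).1 (aff q).1 != 0 by rewrite dot_eq0 aff_neq0.
by have := nz j; have := nz p; move=> ? ?; field; apply/andP.
Qed.

(** Both Cartan integers are at most -1, so their product, four times the squared cosine, is at
    least 1. *)
Lemma unit_aff_edge j p : edge j p -> dot (unit_aff j) (unit_aff p) <= - 2^-1.
Proof.
move=> jp; have jp' : j != p by case/andP: jp.
have := cartan_unit j p; have := unit_aff_le0 jp'.
have := cartan_edge jp; rewrite edge_sym in jp; have := cartan_edge jp.
set x := cartan _ _ _; set y := cartan _ _ _; set z := dot _ _; nra.
Qed.

Lemma unit_aff_edge_eq j p : edge j p ->
  dot (unit_aff j) (unit_aff p) = - 2^-1 ->
  cartan dot (aff j).1 (aff p).1 = -1.
Proof.
move=> jp zE; have := cartan_unit j p; rewrite zE.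
have := cartan_edge jp; rewrite edge_sym in jp; have := cartan_edge jp.
set x := cartan _ _ _; set y := cartan _ _ _; nra.
Qed.

Section Cycle.
Variable s : seq 'I_n.+1.
Hypotheses (cyc : path.cycle edge s) (us : uniq s) (s3 : (2 < size s)%N).

Lemma next_neq_prev j : j \in s ->
  [/\ next s j != j, prev s j != j & next s j != prev s j].
Proof.
move=> js; have nj : edge j (next s j) by apply: next_cycle.
have pj : edge (prev s j) j by apply: prev_cycle.
split; [by rewrite eq_sym; case/andP: nj|by case/andP: pj|].
(* With [j] rotated to the front, its neighbours are the second and the last letter, distinct since
   there are at least three. *)
have [k s' E] := rot_to js.
have us' : uniq (j :: s') by rewrite -E rot_uniq.
have size_s' : (1 < size s')%N.
  by have := congr1 size E; rewrite size_rot /=; lia.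
rewrite -(next_rot k us) -(prev_rot k us) E next_nth prev_nth !inE eqxx /= eqxx.
case: s' us' size_s' {E} => // q s' /= us' s'0.
have jq : (q == j) = false.
  by apply: negbTE; move: us'; rewrite inE eq_sym negb_or => /andP[/andP[]].
have js' : j \notin s' by move: us'; rewrite inE negb_or => /andP[/andP[]].
rewrite jq (memNindex js').
case: s' us' s'0 js' => // r s' us' _ _ /=.
have -> : nth j (r :: s') (size s') = last r s' by rewrite (last_nth j).
apply: contraL us' => /eqP ->.
by rewrite mem_last !andbF.
Qed.

Let x := \sum_(j in s) unit_aff j.

Lemma cycle_row j : j \in s ->
  dot (unit_aff j) x = 1 + (dot (unit_aff j) (unit_aff (next s j)) +
    (dot (unit_aff j) (unit_aff (prev s j)) +
    \sum_(p in s | [&& p != j, p != next s j & p != prev s j])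
       dot (unit_aff j) (unit_aff p))).
Proof.
move=> js; have [nj pj np] := next_neq_prev js.
rewrite dot_sumr (bigD1 j) //= unit_aff_self; congr (_ + _).
rewrite (bigD1 (next s j)) ?mem_next ?js //=; congr (_ + _).
rewrite (bigD1 (prev s j)) ?mem_prev ?js ?pj 1?eq_sym //=; congr (_ + _).
by apply: eq_bigl => p; rewrite -!andbA.
Qed.

Lemma cycle_row_terms j : j \in s ->
  [/\ dot (unit_aff j) (unit_aff (next s j)) <= - 2^-1,
      dot (unit_aff j) (unit_aff (prev s j)) <= - 2^-1 &
      \sum_(p in s | [&& p != j, p != next s j & p != prev s j])
       dot (unit_aff j) (unit_aff p) <= 0].
Proof.
move=> js; split.
- by apply: unit_aff_edge; apply: next_cycle.
- by apply: unit_aff_edge; rewrite edge_sym; apply: prev_cycle.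
- apply: sumr_le0 => p /andP[_ /and3P[pj _ _]].
  by apply: unit_aff_le0; rewrite eq_sym.
Qed.

(* The unit vectors along a cycle of the diagram add up to a vector of
   nonpositive norm: each meets itself in 1 and its two neighbours in at most
   -1/2. *)
Lemma cycle_sum0 : x = 0.
Proof.
apply/eqP; rewrite -(dot_eq0 dot); apply/eqP/le_anti; rewrite dot_ge0 andbT.
rewrite {1}/x dot_suml sumr_le0 // => j js.
rewrite cycle_row //; have [] := cycle_row_terms js; lra.
Qed.

(** Each row pairs with the zero vector to 0, which leaves no slack in the bounds. *)
Lemma cycle_tight j : j \in s ->
  [/\ dot (unit_aff j) (unit_aff (next s j)) = - 2^-1,
      dot (unit_aff j) (unit_aff (prev s j)) = - 2^-1 &
      \sum_(p in s | [&& p != j, p != next s j & p != prev s j])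
       dot (unit_aff j) (unit_aff p) = 0].
Proof.
move=> js; have := cycle_row js; rewrite cycle_sum0 dot0r.
by have [h1 h2 h3] := cycle_row_terms js => h; split; lra.
Qed.

(** The vanishing sum is a relation between the affine simple roots, so its coefficients are
    proportional to the marks, none of which is 0. *)
Lemma cycle_full j : j \in s.
Proof.
pose c p : R := if p \in s then (aff_norm p)^-1 else 0.
have /aff_relation cE : \sum_p c p *: (aff p).1 = 0.
  transitivity x; last exact: cycle_sum0.
  rewrite /x [RHS]big_mkcond; apply: eq_bigr => p _.
  by rewrite /c; case: ifP => // _; rewrite scale0r.
have qs : nth ord0 s 0 \in s by rewrite mem_nth // (leq_trans _ s3).
have c0 : c ord0 != 0.
  apply/eqP => c0; have := cE (nth ord0 s 0); rewrite c0 mul0r /c qs.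
  by apply/eqP; rewrite invr_eq0 gt_eqF // aff_norm_gt0.
have : c j != 0 by rewrite cE mulf_neq0 // gt_eqF // mark_gt0.
by rewrite /c; case: ifP => //; rewrite eqxx.
Qed.

Lemma cycle_cartan j p : j != p -> cartan dot (aff j).1 (aff p).1 =
  if (p == next s j) || (p == prev s j) then -1 else 0.
Proof.
move=> jp; have js := cycle_full j; have [h1 h2 h3] := cycle_tight js.
have [->|pn] /= := eqVneq p (next s j).
  by apply: unit_aff_edge_eq h1; apply: next_cycle.
have [->|pp] /= := eqVneq p (prev s j).
  by apply: unit_aff_edge_eq h2; rewrite edge_sym; apply: prev_cycle.
have : dot (unit_aff j) (unit_aff p) = 0.
  apply: oppr_inj; rewrite oppr0; move: h3 => /eqP.
  rewrite -oppr_eq0 -sumrN => /eqP h3.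
  apply: (psumr_eq0P _ h3); last by rewrite cycle_full eq_sym jp pn pp.
  move=> q /andP[_ /and3P[qj _ _]]; rewrite oppr_ge0.
  by apply: unit_aff_le0; rewrite eq_sym.
move/eqP; rewrite unit_affE mulf_eq0 invr_eq0 mulf_eq0.
by rewrite !(gt_eqF (aff_norm_gt0 _)) !orbF /cartan => /eqP ->; rewrite mul0r.
Qed.

Lemma cycle_size : size s = n.+1.
Proof.
apply: coxeter_word_size; apply: uniq_perm; rewrite ?enum_uniq //.
by move=> j; rewrite cycle_full mem_enum.
Qed.

(** With the affine node at its start, the rest of the cycle lists the simple roots in the order of
    a type A diagram. *)
Lemma based_cycle_type_A t : s = ord0 :: t -> type_A dot alpha.
Proof.
move=> st; have szt : size t = n by have := cycle_size; rewrite st => -[].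
have /andP[t0 ut] : uniq (ord0 :: t) by rewrite -st.
have nt (i : 'I_n) : nth ord0 t i \in t by rewrite mem_nth // szt.
(* The default [i] is never reached, as [ord0] does not occur in [t]. *)
pose q i := if unlift ord0 (nth ord0 t i) is Some l then l else i.
have qE i : lift ord0 (q i) = nth ord0 t i.
  rewrite /q; case: unliftP => [l -> //|E].
  by move: t0; rewrite -E nt.
have q_inj : injective q.
  move=> i l /(congr1 (lift ord0)); rewrite !qE => /eqP.
  by rewrite nth_uniq ?szt // => /eqP/val_inj.
have aE i : alpha (q i) = (aff (nth ord0 t i)).1 by rewrite -qE affS.
have next_t (i l : 'I_n) :
    (nth ord0 t i == next s (nth ord0 t l)) = (l.+1 == i :> nat).
  rewrite next_nth cycle_full st /=.
  have -> : (ord0 == nth ord0 t l) = false.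
    by apply: contraNF t0 => /eqP ->.
  rewrite index_uniq ?szt //; have [ln|ln] := ltnP l.+1 n.
    by rewrite nth_uniq ?szt // eq_sym.
  (* After the last letter the cycle wraps around to [ord0], which is not in [t]. *)
  rewrite [nth _ _ l.+1]nth_default ?szt //.
  have -> : (l.+1 == i :> nat) = false.
    by apply: gtn_eqF; apply: leq_trans ln.
  by apply: contraNF t0 => /eqP <-.
exists (perm q_inj) => i l; rewrite !permE dot_coroot !aE.
have [->|il] := eqVneq i l; first by rewrite cartan_self // aff_neq0.
rewrite cycle_cartan; last by rewrite nth_uniq ?szt // eq_sym.
rewrite next_t orbC; congr (if _ || _ then _ else _).
by rewrite -next_t; apply/eqP/eqP => ->; rewrite ?prev_next ?next_prev.
Qed.

End Cycle.

Lemma cycle_type_A s : path.cycle edge s -> uniq s -> (2 < size s)%N ->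
  type_A dot alpha.
Proof.
move=> cyc us s3; have [k t E] := rot_to (cycle_full cyc us s3 ord0).
apply: (@based_cycle_type_A (rot k s)) E; rewrite ?rot_cycle ?rot_uniq //.
by rewrite size_rot.
Qed.

Lemma not_type_A_forest : ~ type_A dot alpha ->
  forall j p, edge j p -> ~~ connect (edge_except j p) j p.
Proof.
move=> nA j p jp; apply/negP => /connectP[s0 path_s0 pE]; apply: nA.
move: pE; case/shortenP: path_s0 => s path_s us _ pE {s0}.
have jp' : j != p by case/andP: jp.
apply: (@cycle_type_A (j :: s)) => //.
  rewrite /path.cycle rcons_path -pE edge_sym jp andbT.
  by apply: sub_path path_s => q r /andP[].
(* A path with a single step would be the removed edge itself, so the closed cycle has at least
   three vertices. *)
case: s path_s pE {us} => [_ /= pj|q [|r s]] //=.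
  by rewrite pj eqxx in jp'.
by move=> + pq; rewrite -pq /edge_except /= !eqxx andbF.
Qed.


Lemma coxeter_node_unique (k : 'I_n -> nat) :
  least_coweight_multiples dot alpha omega k -> ~ type_A dot alpha ->
  forall i l, coxeter_node dot alpha xi Phi omega k i ->
    coxeter_node dot alpha xi Phi omega k l -> i = l.
Proof.
move=> k_least /not_type_A_forest forest i l.
move=> /(coxeter_nodeP k_least)[u pu ui] /(coxeter_nodeP k_least)[u' pu' ul].
have [d E] := forest_conjugate pu pu' forest.
exact: over_node_unique ui ul E.
Qed.

End RootData.

Theorem corollary4p4 (R : realType) (V : vectType R) (dot : {dot V for idfun})
  (Phi : {fset V}) (n : nat) (alpha : 'I_n -> V) (xi : V)
  (omega : 'I_n -> V) (k : 'I_n -> nat)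
  (Phi_root : root_system dot Phi)
  (Phi_irr : irreducible_root_system dot Phi)
  (alpha_simple : simple_roots Phi alpha)
  (xi_highest : highest_root Phi alpha xi)
  (omega_coweights : fundamental_coweights dot alpha omega)
  (k_least : least_coweight_multiples dot alpha omega k) :
  [/\ exists i : 'I_n, coxeter_node dot alpha xi Phi omega k i,
      ~ type_A dot alpha ->
        exists! i : 'I_n, coxeter_node dot alpha xi Phi omega k i
    & forall c : V -> V, coxeter_element dot alpha xi c ->
        minimal_limit_element dot alpha xi (limit_power dot alpha xi c)].
Proof.
have [i node_i] := coxeter_node_exists Phi_root alpha_simple xi_highest
  omega_coweights k_least.
split; first by exists i.
- move=> nA; exists i; split=> // l node_l.
  exact: (coxeter_node_unique Phi_root alpha_simple xi_highest omega_coweights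
    k_least nA).
- move=> _ [u pu ->].
  exact: (coxeter_minimal Phi_root alpha_simple xi_highest omega_coweights).
Qed.
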